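(* Let $T$ be a self-adjoint operator in a complex Hilbert space $\mathcal H$ and let $(\alpha_T,\beta_T)\subset\mathbb R$ be an interval with $\sigma_{\rm ess}(T)\cap(\alpha_T,\beta_T)=\emptyset$ such that $(\alpha_T,\beta_T)$ contains $m<\infty$ eigenvalues of $T$, counted with multiplicity. Let $A$ be a $T$-bounded symmetric operator in $\mathcal H$ with $T$-bound $<1$, and let $a,b\ge0$, $b<1$, be such that $$\|Ax\|^2\le a^2\|x\|^2+b^2\|Tx\|^2,\qquad x\in\mathcal D(T).$$ Consider the following cases: (i) if $\sqrt{a^2+b^2\alpha_T^2}+\sqrt{a^2+b^2\beta_T^2}<\beta_T-\alpha_T$, set $$(\alpha_{T+A},\beta_{T+A}):=\Big(\alpha_T+\sqrt{a^2+b^2\alpha_T^2},\ \beta_T-\sqrt{a^2+b^2\beta_T^2}\Big);$$ (ii) if $A$ is bounded above and $\sup W(A)+\sqrt{a^2+b^2\beta_T^2}<\beta_T-\alpha_T$, set $$(\alpha_{T+A},\beta_{T+A}):=\Big(\alpha_T+\sup W(A),\ \beta_T-\sqrt{a^2+b^2\beta_T^2}\Big);$$ (iii) if $A$ is bounded below and $\sqrt{a^2+b^2\alpha_T^2}-\inf W(A)<\beta_T-\alpha_T$, set $$(\alpha_{T+A},\beta_{T+A}):=\Big(\alpha_T+\sqrt{a^2+b^2\alpha_T^2},\ \beta_T+\inf W(A)\Big);$$ (iv) if $A$ is bounded and $\sup W(A)-\inf W(A)<\beta_T-\alpha_T$, set $$(\alpha_{T+A},\beta_{T+A}):=\big(\alpha_T+\sup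 W(A),\ \beta_T+\inf W(A)\big).$$ Then, in each case, $(\alpha_{T+A},\beta_{T+A})$ contains at most $m$ isolated eigenvalues of $T+A$, counted with algebraic multiplicity. In particular, if $(\alpha_T,\beta_T)$ contains no eigenvalues of $T$, then $(\alpha_{T+A},\beta_{T+A})$ contains no eigenvalues of $T+A$.
   Context: $\mathcal D(\cdot)$ denotes the domain. A linear operator $A$ is $T$-bounded if $\mathcal D(T)\subset\mathcal D(A)$ and there are $a,b\ge0$ with $\|Ax\|^2\le a^2\|x\|^2+b^2\|Tx\|^2$ for all $x\in\mathcal D(T)$; the infimum of all $b\ge 0$ for which such an $a\ge 0$ exists is the $T$-bound of $A$. The operator $T+A$ has domain $\mathcal D(T)$ (it is self-adjoint by the Kato–Rellich theorem). $W(A):=\{(Ax,x):x\in\mathcal D(A),\ \|x\|=1\}$ is the numerical range of $A$; $A$ is bounded above (below) if $\sup W(A)<\infty$ ($\inf W(A)>-\infty$). $\sigma_{\rm ess}(T):=\{\lambda\in\mathbb C:T-\lambda\text{ is not Fredholm}\}$. *)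

(* Defs.v *)
From HB Require Import structures.
From mathcomp Require Import all_boot all_order all_algebra.
From mathcomp Require Import complex.
From mathcomp Require Import all_classical all_reals all_analysis.

Set Implicit Arguments.
Unset Strict Implicit.
Unset Printing Implicit Defensive.

Import Order.TTheory GRing.Theory Num.Theory.
Import numFieldNormedType.Exports.

Local Open Scope classical_set_scope.
Local Open Scope ring_scope.
Local Open Scope complex_scope.

(* The inner product is linear in its first argument and conjugate-linear in
   its second one. *)
HB.mixin Record CompleteNormedModule_isHilbert (R : realType) (H : Type)
    of CompleteNormedModule R[i] H := {
  inner : {dot H for (@Num.conj R[i])} ;
  sqr_normE : forall x : H, `|x| ^+ 2 = inner x x
}.

#[short(type="hilbertType")]
HB.structure Definition Hilbert (R : realType) :=
  {H of CompleteNormedModule_isHilbert R H & CompleteNormedModule R[i] H}.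

Section FiniteDimension.
Context {R : realType} {H : hilbertType R}.

Definition lin_comb n (v : 'I_n -> H) (c : 'I_n -> R[i]) : H :=
  \sum_(i < n) c i *: v i.

Definition lin_indep n (v : 'I_n -> H) : Prop :=
  forall c, lin_comb v c = 0 -> forall i, c i = 0.

Definition has_dim (V : set H) (n : nat) : Prop :=
  exists2 v : 'I_n -> H, lin_indep v & V = range (lin_comb v).

Definition finite_codim (V : set H) : Prop :=
  exists n (v : 'I_n -> H),
    [set x + y | x in V & y in range (lin_comb v)] = setT.

(* [E] is finite, every [V l] with [l] in [E] is finite-dimensional, and the
   dimensions of these subspaces add up to [n]. *)
Definition total_mult (E : set R[i]) (V : R[i] -> set H) (n : nat) : Prop :=
  exists (s : seq R[i]) (d : R[i] -> nat),
    [/\ uniq s, E = [set` s], {in s, forall l, has_dim (V l) (d l)}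
      & (\sum_(l <- s) d l)%N = n].

End FiniteDimension.

(* A possibly unbounded operator, given by a total function of which only the
   restriction to [dom] is meaningful. *)
Record operator (R : realType) (H : hilbertType R) := Operator {
  dom : set H ;
  op_fun :> H -> H ;
  dom0 : dom 0 ;
  dom_linear : forall (c : R[i]) (x y : H),
    dom x -> dom y -> dom (c *: x + y) ;
  op_linear : forall (c : R[i]) (x y : H), dom x -> dom y ->
    op_fun (c *: x + y) = c *: op_fun x + op_fun y
}.

Section Operators.
Context {R : realType} {H : hilbertType R}.
Implicit Types T A : operator H.

Lemma op_add_dom T A (c : R[i]) (x y : H) :
  (dom T `&` dom A) x -> (dom T `&` dom A) y -> (dom T `&` dom A) (c *: x + y).
Proof. by move=> [Tx Ax] [Ty Ay]; split; apply: dom_linear. Qed.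

Lemma op_add_linear T A (c : R[i]) (x y : H) :
  (dom T `&` dom A) x -> (dom T `&` dom A) y ->
  T (c *: x + y) + A (c *: x + y) = c *: (T x + A x) + (T y + A y).
Proof.
by move=> [Tx Ax] [Ty Ay]; rewrite !op_linear// scalerDr addrACA.
Qed.

Definition op_add T A : operator H :=
  @Operator R H (dom T `&` dom A) (fun x => T x + A x)
    (conj (dom0 T) (dom0 A)) (@op_add_dom T A) (@op_add_linear T A).

Lemma op_add_domE T A : dom T `<=` dom A -> dom (op_add T A) = dom T.
Proof. by move=> /setIidl. Qed.

Lemma op_scalar_linear (l c : R[i]) (x y : H) : setT x -> setT y ->
  l *: (c *: x + y) = c *: (l *: x) + l *: y.
Proof. by move=> _ _; rewrite scalerDr !scalerA mulrC. Qed.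

Definition op_scalar (l : R[i]) : operator H :=
  @Operator R H setT (fun x => l *: x) I (fun _ _ _ _ _ => I)
    (@op_scalar_linear l).

(* The operator T - l. *)
Definition op_shift T (l : R[i]) : operator H := op_add T (op_scalar (- l)).

Definition op_graph T : set (H * H) := [set p | dom T p.1 /\ p.2 = T p.1].

Definition op_ran T : set H := T @` dom T.

Definition op_ker T : set H := [set x | dom T x /\ T x = 0].

(* The kernel of T^k, with the usual domain of T^k. *)
Fixpoint ker_pow T (k : nat) : set H :=
  if k is k'.+1 then [set x | dom T x /\ ker_pow T k' (T x)] else [set 0].

(* [(y, z)] belongs to it iff [y] is in the domain of T^* and [z = T^* y]. *)
Definition adjoint_graph T : set (H * H) :=
  [set p | forall x, dom T x -> inner (T x) p.1 = inner x p.2].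

Definition self_adjoint T : Prop :=
  dense (dom T) /\ adjoint_graph T = op_graph T.

Definition symmetric_op A : Prop :=
  dense (dom A) /\
  forall x y, dom A x -> dom A y -> inner (A x) y = inner x (A y).

Definition bounded_op A : Prop :=
  exists M : R, forall x, dom A x -> `|A x| <= M%:C * `|x|.

Definition rel_ineq T A (a b : R) : Prop :=
  forall x, dom T x ->
    `|A x| ^+ 2 <= (a ^+ 2)%:C * `|x| ^+ 2 + (b ^+ 2)%:C * `|T x| ^+ 2.

Definition rel_bounded T A : Prop :=
  dom T `<=` dom A /\ exists a b : R, [/\ 0 <= a, 0 <= b & rel_ineq T A a b].

Definition rel_bound T A : R :=
  inf [set b : R | 0 <= b /\ exists2 a : R, 0 <= a & rel_ineq T A a b].

Definition num_range A : set R[i] :=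
  [set inner (A x) x | x in dom A `&` [set x | `|x| = 1]].

(* For symmetric [A] the numerical range is real, so that taking real parts
   only changes its type. *)
Definition real_num_range A : set R := (@complex.Re R) @` num_range A.

Definition supW A : R := sup (real_num_range A).

Definition infW A : R := inf (real_num_range A).

Definition bounded_above A : Prop := has_ubound (real_num_range A).

Definition bounded_below A : Prop := has_lbound (real_num_range A).

Definition fredholm T : Prop :=
  [/\ closed (op_graph T), closed (op_ran T), exists n, has_dim (op_ker T) n
    & finite_codim (op_ran T)].

Definition ess_spectrum T : set R[i] := [set l | ~ fredholm (op_shift T l)].

Definition bounded_inverse T : Prop :=
  [/\ set_inj (dom T) T, op_ran T = setT
    & exists M : R, forall x, dom T x -> `|x| <= M%:C * `|T x|].

Definition spectrum T : set R[i] := [set l | ~ bounded_inverse (op_shift T l)].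

Definition eigenvalues T : set R[i] :=
  [set l | exists x, [/\ dom T x, x != 0 & T x = l *: x]].

Definition isolated_eigenvalues T : set R[i] :=
  eigenvalues T `&` isolated (spectrum T : set R[i]^o).

Definition op_eigenspace T (l : R[i]) : set H := op_ker (op_shift T l).

(* Its dimension is the algebraic multiplicity of [l]. *)
Definition root_space T (l : R[i]) : set H := \bigcup_k ker_pow (op_shift T l) k.

End Operators.

Definition complex_itv {R : realType} (s t : R) : set R[i] :=
  [set x%:C | x in `]s, t[].

(* Main.v *)
Require Import Defs.
From HB Require Import structures.
From mathcomp Require Import all_boot all_order all_algebra.
From mathcomp Require Import complex.
From mathcomp Require Import all_classical all_reals all_analysis.
From mathcomp Require Import ring lra.

Set Implicit Arguments.
Unset Strict Implicit.
Unset Printing Implicit Defensive.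

Import Order.TTheory GRing.Theory Num.Theory.
Import numFieldNormedType.Exports.

Local Open Scope classical_set_scope.
Local Open Scope ring_scope.

(* For every mu in the gap (alphaT, betaT), T - mu has a bounded inverse on the
   orthogonal complement of the m eigenvectors of T. The sign of one such
   inverse splits this complement into two reducing subspaces of T, on which
   T <= alphaT and T >= betaT respectively.
   In each of the four cases T + A is, as a quadratic form, at most alphaTA on
   the first and at least betaTA on the second one: for the relative bound this
   is the inequality |(Ax, x)| <= (Gx, x), where G is +-(T - mu) and A is
   dominated by G in norm. Testing (T + A - c)x, c the midpoint of
   (alphaTA, betaTA), against the difference x+ - x- of the two components of x
   gives ||(T + A - c)x|| >= (betaTA - alphaTA)/2 ||x|| for every x in the domain
   that is orthogonal to the m eigenvectors. A combination of m + 1 orthogonal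
   eigenvectors of T + A with eigenvalues in (alphaTA, betaTA) can be chosen
   orthogonal to the m eigenvectors of T, and violates this inequality. *)

(** * The real inner product *)

(** Three difficulties shape the proof. First, the sign of the inverse at the midpoint c of the gap
    separates only T >= c from T <= c. A supremum argument carries the bound to the edges: if T - g
    has a nonnegative form and g lies in the gap, the bounded inverse makes that form strictly
    positive. Second, [A] and T need not commute, so |(Ax, x)| <= (Gx, x) does not follow at once
    from ||Ax|| <= ||Gx||. Here G is s (T - t) + f + e with t an edge and s = 1 or -1; the choice f
    = sqrt (a^2 + b^2 t^2) makes the norm domination hold term by term, and e > 0 is arbitrary.
    Third, [A] need not respect the splitting of x; the test vector x+ - x- cancels the mixed terms
    because T + A is symmetric. Forms of symmetric operators are real, so projections and bounded
    operators are treated over the real inner product; complex scalars return in the adjoint and in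
    counting dimensions. *)

Section InnerProduct.
Local Open Scope complex_scope.
Context {R : realType} {H : hilbertType R}.
Implicit Types x y z : H.

Lemma innerC x y : inner x y = conjc (inner y x).
Proof. by rewrite (@hermC _ false _ _ inner) expr0 mul1r. Qed.

Lemma innerDl x y z : inner (x + y) z = inner x z + inner y z.
Proof. exact: linearDl. Qed.

Lemma innerDr z x y : inner z (x + y) = inner z x + inner z y.
Proof. exact: linearDr. Qed.

Lemma innerZl (c : R[i]) x y : inner (c *: x) y = c * inner x y.
Proof. exact: linearZl_LR. Qed.

Lemma innerZr (c : R[i]) x y : inner x (c *: y) = conjc c * inner x y.
Proof. by rewrite innerC innerZl rmorphM /= -innerC. Qed.

(* Real-valued counterparts of the inner product, of the squared norm and (in
   [hn]) of the norm, whose library version takes values in [R[i]]. *)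
Definition rip x y : R := complex.Re (inner x y).
Definition nn x : R := rip x x.

Lemma ripC x y : rip x y = rip y x.
Proof. by rewrite /rip innerC; case: (inner y x). Qed.

Lemma ripDl x y z : rip (x + y) z = rip x z + rip y z.
Proof. by rewrite /rip innerDl raddfD. Qed.

Lemma ripDr z x y : rip z (x + y) = rip z x + rip z y.
Proof. by rewrite ripC ripDl !(ripC z). Qed.

Lemma ripZl (k : R) x y : rip (k%:C *: x) y = k * rip x y.
Proof. by rewrite /rip innerZl; case: (inner x y) => u v /=; rewrite mul0r subr0. Qed.

Lemma ripZr (k : R) x y : rip x (k%:C *: y) = k * rip x y.
Proof. by rewrite ripC ripZl ripC. Qed.

Lemma ripNl x y : rip (- x) y = - rip x y.
Proof. by have := ripZl (-1) x y; rewrite rmorphN1 scaleN1r mulN1r. Qed.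

Lemma ripNr x y : rip x (- y) = - rip x y.
Proof. by rewrite ripC ripNl ripC. Qed.

Lemma rip0l y : rip 0 y = 0.
Proof. by have := ripZl 0 0 y; rewrite scaler0 mul0r. Qed.

Lemma rip0r y : rip y 0 = 0.
Proof. by rewrite ripC rip0l. Qed.

Definition ripE := (ripDl, ripDr, ripNl, ripNr, ripZl, ripZr, rip0l, rip0r).

Lemma innerE x y : inner x y = (rip x y) +i* (rip x ('i%C *: y)).
Proof.
rewrite /rip innerZr; case: (inner x y) => u v /=.
by congr (_ +i* _); rewrite /= ; ring.
Qed.

Lemma inner_nn x : inner x x = (nn x)%:C.
Proof.
rewrite innerE /rip innerZr /nn /rip.
have := innerC x x; case: (inner x x) => u v [] /= e.
have -> : v = 0 by lra.
by congr (_ +i* _); ring.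
Qed.

Lemma sqr_norm_nn x : `|x| ^+ 2 = (nn x)%:C.
Proof. by rewrite sqr_normE inner_nn. Qed.

Lemma nn_ge0 x : 0 <= nn x.
Proof. by rewrite -lecR -sqr_norm_nn exprn_ge0. Qed.

Lemma nn_eq0 x : (nn x == 0) = (x == 0).
Proof. by rewrite -(inj_eq (@complexI R)) -sqr_norm_nn sqrf_eq0 normr_eq0. Qed.

Lemma nn_gt0 x : (0 < nn x) = (x != 0).
Proof. by rewrite lt_neqAle nn_ge0 andbT eq_sym nn_eq0. Qed.

Lemma nn0 : nn 0 = 0. Proof. exact: rip0l. Qed.

Lemma norm_nn x : `|x| = (Num.sqrt (nn x))%:C.
Proof.
apply/eqP; rewrite -(@eqrXn2 _ 2)// ?normr_ge0 ?lecR ?sqrtr_ge0//.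
by rewrite sqr_norm_nn -rmorphXn sqr_sqrtr ?nn_ge0.
Qed.

Lemma nnZ (k : R) x : nn (k%:C *: x) = k ^+ 2 * nn x.
Proof. by rewrite /nn !ripE; ring. Qed.

Lemma nnD x y : nn (x + y) = nn x + 2 * rip x y + nn y.
Proof. by rewrite /nn !ripE (ripC y x); ring. Qed.

Lemma nnN x : nn (- x) = nn x.
Proof. by rewrite /nn !ripE; ring. Qed.

Lemma nnB x y : nn (x - y) = nn x - 2 * rip x y + nn y.
Proof. by rewrite /nn !ripE (ripC y x); ring. Qed.

Lemma rip_eq0_all x : (forall y, rip x y = 0) -> x = 0.
Proof. by move=> h; apply/eqP; rewrite -nn_eq0 /nn h. Qed.

Lemma rip_inj x y : (forall z, rip x z = rip y z) -> x = y.
Proof.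
move=> h; apply/subr0_eq/rip_eq0_all => z.
by rewrite !ripE h subrr.
Qed.

End InnerProduct.

(** * Limits and orthogonal projections *)

Section HilbertGeometry.
Local Open Scope complex_scope.
Context {R : realType} {H : hilbertType R}.
Implicit Types x y z : H.

(** Discriminant criterion behind every Cauchy-Schwarz inequality below. The case r = 0 is covered,
    since the second vector may be degenerate for the form. *)
Lemma quadratic_ge0 (p q r : R) :
  0 <= r -> (forall t, 0 <= p + 2 * t * q + t ^+ 2 * r) -> q ^+ 2 <= p * r.
Proof.
rewrite le_eqVlt => /predU1P[<-|r_gt0] h.
  have [->|q_neq0] := eqVneq q 0; first by rewrite expr0n mulr0.
  have := h (- (p + 1) / (2 * q)).
  have -> : p + 2 * (- (p + 1) / (2 * q)) * q
      + (- (p + 1) / (2 * q)) ^+ 2 * 0 = -1 by field.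
  by rewrite ler0N1.
have := h (- (q / r)).
have -> : p + 2 * - (q / r) * q + (- (q / r)) ^+ 2 * r = p - q ^+ 2 / r.
  by field; rewrite gt_eqF.
by rewrite subr_ge0 ler_pdivrMr.
Qed.

Lemma rip_sqr_le x y : rip x y ^+ 2 <= nn x * nn y.
Proof.
apply: quadratic_ge0 => [|t]; first exact: nn_ge0.
by have := nn_ge0 (x + t%:C *: y); rewrite nnD nnZ !ripE mulrA.
Qed.

Definition hn x : R := Num.sqrt (nn x).

Lemma hn_ge0 x : 0 <= hn x. Proof. exact: sqrtr_ge0. Qed.

Lemma sqr_hn x : hn x ^+ 2 = nn x.
Proof. by rewrite sqr_sqrtr ?nn_ge0. Qed.

Lemma norm_hn x : `|x| = (hn x)%:C. Proof. exact: norm_nn. Qed.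

Lemma hn0 : hn 0 = 0. Proof. by rewrite /hn nn0 sqrtr0. Qed.

Lemma hn_eq0 x : (hn x == 0) = (x == 0).
Proof. by rewrite -nn_eq0 -sqr_hn sqrf_eq0. Qed.

Lemma hn_le x y : (hn x <= hn y) = (nn x <= nn y).
Proof. by rewrite -!sqr_hn ler_sqr ?nnegrE ?hn_ge0. Qed.

Lemma hnZ (k : R) x : hn (k%:C *: x) = `|k| * hn x.
Proof. by rewrite /hn nnZ sqrtrM ?sqr_ge0// sqrtr_sqr. Qed.

Lemma hnN x : hn (- x) = hn x. Proof. by rewrite /hn nnN. Qed.

Lemma hnBC x y : hn (x - y) = hn (y - x). Proof. by rewrite -hnN opprB. Qed.

Lemma rip_le x y : `|rip x y| <= hn x * hn y.
Proof.
rewrite -ler_sqr ?nnegrE ?mulr_ge0 ?hn_ge0// exprMn !sqr_hn real_normK ?num_real//.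
exact: rip_sqr_le.
Qed.

Lemma hnD x y : hn (x + y) <= hn x + hn y.
Proof.
rewrite -ler_sqr ?nnegrE ?addr_ge0 ?hn_ge0// sqrrD !sqr_hn nnD.
have := ler_norm (rip x y); have := rip_le x y; lra.
Qed.

Lemma hnBB x y z : hn (x - z) <= hn (x - y) + hn (y - z).
Proof. by rewrite (le_trans _ (hnD _ _))// addrA subrK. Qed.

Definition lim_to (u : nat -> H) l :=
  forall e : R, 0 < e -> exists N, forall n, (N <= n)%N -> hn (u n - l) <= e.

Lemma complex_gt0 (e : R[i]) : 0 < e -> exists2 r : R, 0 < r & e = r%:C.
Proof.
move=> e_gt0; have e_re : e = (complex.Re e)%:C by rewrite RRe_real// gtr0_real.
by exists (complex.Re e) => //; rewrite -ltcR -e_re.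
Qed.

Lemma lim_to_cvg (u : nat -> H) l : lim_to u l <-> u @ \oo --> l.
Proof.
split=> [ul|/cvgrPdist_le ul e e_gt0].
  apply/cvgrPdist_le => _ /complex_gt0[e e_gt0 ->].
  have [N Nu] := ul e e_gt0.
  by exists N => // n /= Nn; rewrite distrC norm_hn lecR Nu.
have [|N _ Nu] := ul e%:C; first by rewrite ltcR.
by exists N => n Nn; have := Nu n Nn; rewrite distrC norm_hn lecR.
Qed.

Lemma closed_lim_to (M : set H) u l :
  closed M -> (forall n, M (u n)) -> lim_to u l -> M l.
Proof.
by move=> clM Mu /lim_to_cvg ul; apply: (closed_cvg M) ul => //; exists 0.
Qed.

Definition hcauchy (u : nat -> H) :=
  forall e : R, 0 < e ->
  exists N, forall m n, (N <= m)%N -> (N <= n)%N -> hn (u m - u n) <= e.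

Lemma hcauchy_lim u : hcauchy u -> exists l, lim_to u l.
Proof.
move=> cu; suff /cvg_ex[l ul] : cvgn u by exists l; apply/lim_to_cvg.
apply/cauchy_cvgP/cauchy_ballP => _ /complex_gt0[e e_gt0 ->].
have [N Nu] := cu (e / 2) (divr_gt0 e_gt0 (ltr0Sn _ 1)).
exists ([set u n | n in [set n | (N <= n)%N]],
        [set u n | n in [set n | (N <= n)%N]]).
  by split; exists N => // n Nn; exists n.
move=> [_ _] [/= [m Nm <-] [n Nn <-]].
rewrite -ball_normE /ball_/= norm_hn ltcR.
by rewrite (le_lt_trans (Nu _ _ Nm Nn))// gtr_pMr// invf_lt1 ?ltr1n.
Qed.

Lemma le_eps0 (a C : R) : 0 <= C -> (forall e, 0 < e -> a <= C * e) -> a <= 0.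
Proof.
move=> C0 h; apply/ler_addgt0Pl => e e0; rewrite addr0.
apply: (le_trans (h (e / (C + 1)) _)); first by rewrite divr_gt0// ltr_wpDl.
by rewrite mulrA ler_pdivrMr ?ltr_wpDl//; nra.
Qed.

Lemma lim_to_hn_le u l (c : R) :
  lim_to u l -> (forall n, hn (u n) <= c) -> hn l <= c.
Proof.
move=> ul uc; apply/ler_addgt0Pl => e e0; have [N /(_ N (leqnn N)) h] := ul e e0.
have := hnBB l (u N) 0; rewrite !subr0 hnBC; move: h (uc N); lra.
Qed.

(** Continuity in the shape in which it is applied: it gives uniqueness of limits, symmetry of limit
    operators and closedness of a self-adjoint operator. *)
Lemma lim_to_rip_eq u w l k y z : lim_to u l -> lim_to w k ->
  (forall n, rip (u n) y = rip (w n) z) -> rip l y = rip k z.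
Proof.
move=> ul wk uw; apply/subr0_eq/eqP; rewrite -normr_le0.
apply: (@le_eps0 _ (hn y + hn z)) => [|e e0]; first by rewrite addr_ge0 ?hn_ge0.
have [N /(_ _ (leq_maxl _ _)) Nu] := ul e e0.
have [N' /(_ _ (leq_maxr _ _)) Nw] := wk e e0.
move: Nu Nw => /(_ N') Nu /(_ N) Nw; set n := maxn N N' in Nu Nw.
have -> : rip l y - rip k z = rip (w n - k) z - rip (u n - l) y.
  by rewrite !ripE uw; ring.
rewrite (le_trans (ler_normB _ _))// addrC mulrDl.
rewrite lerD// (le_trans (rip_le _ _))// mulrC ler_wpM2l ?hn_ge0//.
Qed.

Lemma lim_to_unique u l k : lim_to u l -> lim_to u k -> l = k.
Proof. by move=> ul uk; apply: rip_inj => z; apply: lim_to_rip_eq ul uk _. Qed.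

Lemma lim_toD u w l k :
  lim_to u l -> lim_to w k -> lim_to (fun n => u n + w n) (l + k).
Proof. by move=> /lim_to_cvg ul /lim_to_cvg wk; apply/lim_to_cvg; apply: cvgD. Qed.

Lemma lim_toZ u l (c : R[i]) : lim_to u l -> lim_to (fun n => c *: u n) (c *: l).
Proof. by move=> /lim_to_cvg ul; apply/lim_to_cvg; apply: cvgZr. Qed.

Lemma lim_to_cst l : lim_to (fun=> l) l.
Proof. by move=> e e0; exists 0%N => n _; rewrite subrr hn0 ltW. Qed.

Lemma lim_toS u l : lim_to u l -> lim_to (fun n => u n.+1) l.
Proof. by move=> ul e /ul[N Nu]; exists N => n Nn; apply/Nu/leqW. Qed.

Lemma invn_small (e : R) : 0 < e -> exists N, forall n, (N <= n)%N -> n.+1%:R^-1 <= e.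
Proof.
move=> e0; exists (Num.truncn e^-1) => n Nn.
rewrite -[e]invrK lef_pV2 ?posrE ?invr_gt0//.
rewrite ltW// (lt_le_trans (truncnS_gt _))// ler_nat ltnS//.
Qed.

(* The minimizing sequence is Cauchy by the parallelogram identity. *)
Lemma projection_exists (M : set H) y : M 0 ->
  (forall (k : R) u v, M u -> M v -> M (k%:C *: u + v)) ->
  (forall u l, (forall n, M (u n)) -> lim_to u l -> M l) ->
  exists2 p, M p & forall u, M u -> rip (y - p) u = 0.
Proof.
move=> M0 Ml Mc.
pose S := [set nn (y - u) | u in M].
have S0 : S !=set0 by exists (nn (y - 0)), 0.
have lbS : has_lbound S by exists 0 => _ [u _ <-]; exact: nn_ge0.
have dS u : M u -> inf S <= nn (y - u) by move=> Mu; apply: ge_inf => //; exists u.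
have /choice[m mP] : forall n : nat, exists u, M u /\ nn (y - u) <= inf S + n.+1%:R^-1.
  move=> n; have [|_ [u Mu <-] /ltW h] := @inf_adherent _ S n.+1%:R^-1 _ (conj S0 lbS).
    by rewrite invr_gt0.
  by exists u.
have mM n : M (m n) by have [] := mP n.
have md n : nn (y - m n) <= inf S + n.+1%:R^-1 by have [] := mP n.
have mid u v : M u -> M v -> nn (u - v) <= 2 * nn (y - u) + 2 * nn (y - v) - 4 * inf S.
  move=> Mu Mv.
  have := dS ((2^-1)%:C *: (u + v)); rewrite -[(2^-1)%:C *: _]addr0.
  have Muv : M (u + v) by have := Ml 1 u v Mu Mv; rewrite scale1r.
  move=> /(_ (Ml _ _ _ Muv M0)); rewrite addr0 !nnB nnZ nnD !ripE; lra.
have [p mp] : exists p, lim_to m p.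
  apply: hcauchy_lim => e e0; have [N Ne] := invn_small (divr_gt0 (exprn_gt0 2 e0) (ltr0Sn _ 3)).
  exists N => i j Ni Nj.
  rewrite -ler_sqr ?nnegrE ?hn_ge0 ?(ltW e0)// sqr_hn.
  have := mid _ _ (mM i) (mM j); have := md i; have := md j.
  have := Ne i Ni; have := Ne j Nj.
  by move: (i.+1%:R^-1) (j.+1%:R^-1) => a b; lra.
exists p => [|u Mu]; first exact: Mc mp.
have small n : rip (y - m n) u ^+ 2 <= n.+1%:R^-1 * nn u.
  apply: quadratic_ge0 => [|t]; first exact: nn_ge0.
  have := dS (((- t)%:C) *: u + m n) (Ml _ _ _ Mu (mM n)).
  have -> : y - (((- t)%:C) *: u + m n) = y - m n + t%:C *: u.
    by rewrite opprD addrCA rmorphN scaleNr opprK [RHS]addrC; congr (_ + _).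
  by rewrite nnD nnZ ripZr; have := md n; move: (n.+1%:R^-1) => c; lra.
apply/eqP; rewrite -normr_le0.
apply: (@le_eps0 _ (hn u + hn u)) => [|e e0]; first by rewrite addr_ge0 ?hn_ge0.
have [N /(_ _ (leq_maxl _ _)) Nm] := mp e e0.
have [N' /(_ _ (leq_maxr _ _)) Ne] := invn_small (exprn_gt0 2 e0).
move: Nm Ne => /(_ N') Nm /(_ N) Ne; set n := maxn N N' in Nm Ne.
have -> : rip (y - p) u = rip (y - m n) u + rip (m n - p) u by rewrite !ripE; ring.
rewrite (le_trans (ler_normD _ _))// mulrDl lerD//.
  rewrite -ler_sqr ?nnegrE ?mulr_ge0 ?hn_ge0 ?(ltW e0)// real_normK ?num_real//.
  rewrite (le_trans (small n))// exprMn sqr_hn mulrC ler_wpM2l ?nn_ge0//.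
by rewrite (le_trans (rip_le _ _))// mulrC ler_wpM2l ?hn_ge0.
Qed.

End HilbertGeometry.

(** * Bounded symmetric operators *)

Section BoundedSymmetric.
Local Open Scope complex_scope.
Context {R : realType} {H : hilbertType R}.
Implicit Types (x y z : H) (B : H -> H).

Definition rsym B := forall x y, rip (B x) y = rip x (B y).

Lemma rsymD B x y : rsym B -> B (x + y) = B x + B y.
Proof. by move=> sB; apply: rip_inj => z; rewrite sB !ripDl !sB. Qed.

Lemma rsymZ B (k : R) x : rsym B -> B (k%:C *: x) = k%:C *: B x.
Proof. by move=> sB; apply: rip_inj => z; rewrite sB !ripZl sB. Qed.

Lemma rsymN B x : rsym B -> B (- x) = - B x.
Proof. by move=> sB; apply: rip_inj => z; rewrite sB !ripNl sB. Qed.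

Lemma rsymB B x y : rsym B -> B (x - y) = B x - B y.
Proof. by move=> sB; rewrite rsymD// rsymN. Qed.

Lemma rsym0 B : rsym B -> B 0 = 0.
Proof. by move=> sB; apply: rip_inj => z; rewrite sB !rip0l. Qed.

(** Method of majorants: [s] is nondecreasing because norms are nonnegative, and being bounded it is
    Cauchy, so [u] is Cauchy as well. *)
Lemma telescope_lim (u : nat -> H) (s : nat -> R) (C : R) :
  (forall n, hn (u n.+1 - u n) <= s n.+1 - s n) -> (forall n, s n <= C) ->
  exists2 l, lim_to u l & forall n, hn (u n - l) <= C - s n.
Proof.
move=> us sC.
have step n k : hn (u (n + k)%N - u n) <= s (n + k)%N - s n.
  elim: k => [|k IH]; first by rewrite addn0 !subrr hn0.
  rewrite addnS; have := hnBB (u (n + k).+1) (u (n + k)%N) (u n).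
  have := us (n + k)%N; move: IH; lra.
have mono n m : (n <= m)%N -> hn (u m - u n) <= s m - s n.
  by move=> nm; rewrite -(subnKC nm) step.
pose S := range s.
have supS : has_sup S by split; [exists (s 0%N), 0%N|exists C => _ [n _ <-]].
have le_sup n : s n <= sup S by apply: sup_upper_bound => //; exists n.
have cu : hcauchy u.
  move=> e e0; have [_ [N _ <-] sN] := sup_adherent e0 supS.
  exists N => m n Nm Nn.
  have := mono _ _ Nm; have := mono _ _ Nn; have := hn_ge0 (u m - u N).
  have := hn_ge0 (u n - u N); have := le_sup m; have := le_sup n.
  have [nm|/ltnW mn] := leqP n m.
    have := mono _ _ nm; lra.
  by rewrite (hnBC (u m) (u n)); have := mono _ _ mn; lra.
have [l ul] := hcauchy_lim cu; exists l => // n.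
apply/ler_addgt0Pl => e e0; have [N Nu] := ul e e0.
have := Nu _ (leq_maxl N n); have := mono _ _ (leq_maxr N n).
rewrite hnBC; have := hnBB (u n) (u (maxn N n)) l; have := sC (maxn N n).
lra.
Qed.

(* Sokal's gliding hump argument. *)
Lemma hellinger_toeplitz B : rsym B ->
  exists2 M, 0 < M & forall x, hn (B x) <= M * hn x.
Proof.
move=> sB; apply: contrapT => nB.
(* The size 2 * 3^n * n is dictated by the end of the argument: step n contributes 3^-n ||B y_n||,
   later steps destroy at most half of it, and n must remain. *)
have /choice[y yP] : forall n : nat, exists x,
    hn x = 1 /\ 2 * 3 ^+ n * n%:R <= hn (B x).
  move=> n; pose M : R := 2 * 3 ^+ n * n%:R + 1.
  have M0 : 0 < M.
    by rewrite /M ltr_wpDl// !mulr_ge0// exprn_ge0.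
  have [x /negP] : exists x, ~ (hn (B x) <= M * hn x).
    by apply: contrapT => h; apply: nB; exists M => // x; apply: contrapT => h'; apply: h; exists x.
  rewrite -ltNge => hx.
  have x0 : 0 < hn x.
    rewrite lt_neqAle hn_ge0 andbT eq_sym hn_eq0; apply: contraTneq hx => ->.
    by rewrite rsym0// hn0 mulr0 ltxx.
  exists ((hn x)^-1%:C *: x); rewrite rsymZ// !hnZ ger0_norm ?invr_ge0 ?hn_ge0//.
  rewrite mulVf ?gt_eqF//; split => //.
  rewrite ler_pdivlMl// mulrC.
  have : M * hn x = 2 * 3 ^+ n * n%:R * hn x + hn x by rewrite /M; ring.
  move: hx x0; lra.
have /choice[f fP] : forall p : nat * H, exists x, hn (x - p.2) <= 3^-1 ^+ p.1 /\
    3^-1 ^+ p.1 * hn (B (y p.1)) <= `|rip x (B (y p.1))|.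
  move=> [n x] /=; set v := B (y n); set r : R := 3^-1 ^+ n.
  have r0 : 0 <= r by rewrite exprn_ge0// invr_ge0.
  have [v0|v0] := eqVneq v 0.
    by exists x; rewrite subrr v0 hn0 mulr0 normr_ge0 r0.
  have hv : 0 < hn v by rewrite lt_neqAle hn_ge0 andbT eq_sym hn_eq0.
  (* This sign makes the added term reinforce [rip x v] instead of cancelling it. *)
  pose d : R := if 0 <= rip x v then 1 else -1.
  have dd : `|d| = 1 by rewrite /d; case: ifP; rewrite ?normrN normr1.
  exists (x + (d * r / hn v)%:C *: v); split.
    rewrite addrAC subrr add0r hnZ !normrM dd mul1r (ger0_norm r0).
    by rewrite (@ger0_norm _ (_^-1)) ?invr_ge0 ?hn_ge0// divfK ?gt_eqF.
  rewrite !ripE -/(nn v) -sqr_hn.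
  have -> : d * r / hn v * hn v ^+ 2 = d * (r * hn v) by field; rewrite gt_eqF.
  have : 0 <= r * hn v by rewrite mulr_ge0 ?hn_ge0.
  rewrite /d; case: ifPn => [h h'|]; first by rewrite mul1r ger0_norm ?addr_ge0// lerDr.
  rewrite -ltNge => h h'; rewrite mulN1r ltr0_norm; last by lra.
  by lra.
pose u := fix u n : H := if n is n'.+1 then f (n', u n') else 0.
have uS n : u n.+1 = f (n, u n) by [].
(* Minus the total length 3^-n + 3^-(n+1) + ... of the remaining steps; its n-th increment is
   3^-n. *)
pose s n : R := - (3 / 2 * 3^-1 ^+ n).
have [||l ul hl] := @telescope_lim u s 0.
- move=> n; rewrite uS /s exprSr; have [/=] := fP (n, u n); lra.
- by move=> n; rewrite oppr_le0 mulr_ge0// exprn_ge0// invr_ge0.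
have le_n n : n%:R <= hn (B l).
  have [y1 yn] := yP n.
  have [_ /=] := fP (n, u n); rewrite -uS => un.
  have := hl n.+1; rewrite /s exprSr sub0r opprK => ln.
  have := rip_le (B l) (y n); rewrite y1 mulr1 sB.
  have := rip_le (u n.+1 - l) (B (y n)).
  have -> : rip l (B (y n)) = rip (u n.+1) (B (y n)) - rip (u n.+1 - l) (B (y n)).
    by rewrite !ripE; ring.
  have := lerB_normD (rip (u n.+1) (B (y n))) (- rip (u n.+1 - l) (B (y n))).
  rewrite normrN.
  have : hn (u n.+1 - l) * hn (B (y n)) <= (2^-1 * 3^-1 ^+ n) * hn (B (y n)).
    apply: ler_wpM2r; first exact: hn_ge0.
    by apply: le_trans ln _; rewrite le_eqVlt; apply/orP; left; apply/eqP; field.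
  have : 2^-1 * 3^-1 ^+ n * (2 * 3 ^+ n * n%:R) <= 2^-1 * 3^-1 ^+ n * hn (B (y n)).
    by rewrite ler_wpM2l// mulr_ge0 ?invr_ge0 ?exprn_ge0 ?invr_ge0.
  have -> : 2^-1 * 3^-1 ^+ n * (2 * 3 ^+ n * n%:R) = n%:R :> R.
    by rewrite exprVn; field; rewrite expf_neq0// pnatr_eq0.
  move: un; lra.
have := le_n (Num.truncn (hn (B l))).+1.
by apply/negP; rewrite -ltNge truncnS_gt.
Qed.

(** * Square roots by iteration *)

Section SquareRoot.
Variable X : H -> H.
Hypotheses (sX : rsym X) (X1 : forall x, hn (X x) <= hn x).

(* The Newton-like iteration for [1 - sqrt (1 - X)] is dominated by the same
   iteration for the scalar [1]. *)
Fixpoint sqrt_iter n : H -> H :=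
  if n is n'.+1 then
    fun x => (2^-1)%:C *: (X x + sqrt_iter n' (sqrt_iter n' x))
  else fun=> 0.

Fixpoint scalar_iter n : R :=
  if n is n'.+1 then (1 + scalar_iter n' ^+ 2) / 2 else 0.

Lemma scalar_iter_bounds n : 0 <= scalar_iter n <= 1.
Proof. by elim: n => [|n /andP[? ?]] /=; apply/andP; split; rewrite ?ler01//; nra. Qed.

Lemma sqrt_iter_sym n : rsym (sqrt_iter n).
Proof.
elim: n => [x y|n IH x y] /=; first by rewrite rip0l rip0r.
by rewrite !ripE sX !IH.
Qed.

Lemma sqrt_iter_comm C n : rsym C -> (forall x, C (X x) = X (C x)) ->
  forall x, C (sqrt_iter n x) = sqrt_iter n (C x).
Proof.
move=> sC CX; elim: n => [x|n IH x] /=; first by rewrite rsym0.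
by rewrite rsymZ// rsymD// CX !IH.
Qed.

Lemma sqrt_iter_bound n x : hn (sqrt_iter n x) <= scalar_iter n * hn x.
Proof.
elim: n x => [x|n IH x] /=; first by rewrite hn0 mul0r.
rewrite hnZ ger0_norm ?invr_ge0//.
have := hnD (X x) (sqrt_iter n (sqrt_iter n x)); have := X1 x.
have := IH (sqrt_iter n x).
have : scalar_iter n * hn (sqrt_iter n x) <= scalar_iter n * (scalar_iter n * hn x).
  by rewrite ler_wpM2l//; have /andP[] := scalar_iter_bounds n.
lra.
Qed.

(** The iterates are polynomials in [X] and commute, so the difference of squares in the recursion
    factors as (p + q)(p - q). The scalar recursion factors in the same way, which closes the
    induction. *)
Lemma sqrt_iter_step n x :
  hn (sqrt_iter n.+1 x - sqrt_iter n x) <= (scalar_iter n.+1 - scalar_iter n) * hn x.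
Proof.
elim: n x => [x|n IH x].
  rewrite /= subr0 subr0 addr0 hnZ ger0_norm ?invr_ge0// expr0n addr0 mul1r.
  by rewrite ler_wpM2l ?invr_ge0.
set p := sqrt_iter n.+1; set q := sqrt_iter n.
have -> : sqrt_iter n.+2 x - p x = (2^-1)%:C *: (p (p x - q x) + q (p x - q x)).
  have sp : rsym p by exact: sqrt_iter_sym.
  have sq : rsym q by exact: sqrt_iter_sym.
  rewrite (rsymB _ _ sp) (rsymB _ _ sq).
  have -> : p (q x) = q (p x).
    apply: sqrt_iter_comm => // z.
    by rewrite /p -(@sqrt_iter_comm X).
  rewrite {1}/p /= -/q -/(p) addrA subrK -scalerBr; congr (_ *: _).
  by rewrite opprD addrACA subrr add0r.
rewrite hnZ ger0_norm ?invr_ge0//.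
set d := p x - q x.
have := hnD (p d) (q d); have := sqrt_iter_bound n.+1 d.
have := sqrt_iter_bound n d; rewrite -/p -/q.
have : (scalar_iter n.+1 + scalar_iter n) * hn d <=
  (scalar_iter n.+1 + scalar_iter n) * ((scalar_iter n.+1 - scalar_iter n) * hn x).
  rewrite ler_wpM2l ?IH//.
  have /andP[? _] := scalar_iter_bounds n; have /andP[? _] := scalar_iter_bounds n.+1.
  by rewrite addr_ge0.
have -> : scalar_iter n.+2 - scalar_iter n.+1 =
  ((scalar_iter n.+1) ^+ 2 - (scalar_iter n) ^+ 2) / 2 by rewrite /=; lra.
lra.
Qed.

(** The equation says (1 - Y)^2 = 1 - X, and 1 - Y is nonnegative because [Y] is a contraction.
    Commutation passes from the iterates to their limit. *)
Lemma sqrt_exists : exists Y : H -> H,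
  [/\ rsym Y, forall x, hn (Y x) <= hn x,
      forall x, 2%:C *: Y x = X x + Y (Y x) &
      forall C, rsym C -> (forall x, C (X x) = X (C x)) ->
        forall x, C (Y x) = Y (C x)].
Proof.
have lim x : exists l, lim_to (sqrt_iter^~ x) l.
  have [|n|l ul _] := @telescope_lim (sqrt_iter^~ x) (fun n => scalar_iter n * hn x) (hn x).
  - by move=> n; have := sqrt_iter_step n x; rewrite mulrBl.
  - by rewrite ler_piMl ?hn_ge0//; have /andP[] := scalar_iter_bounds n.
  by exists l.
have {lim}[Y YP] := choice lim.
have Yn1 n x : hn (sqrt_iter n x) <= hn x.
  apply: le_trans (sqrt_iter_bound n x) _.
  by rewrite ler_piMl ?hn_ge0//; have /andP[] := scalar_iter_bounds n.
exists Y; split.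
- move=> x y; rewrite (ripC x); apply: (lim_to_rip_eq (YP x) (YP y)) => n.
  by rewrite sqrt_iter_sym ripC.
- by move=> x; apply: (lim_to_hn_le (YP x)).
- move=> x; have YY : lim_to (fun n => sqrt_iter n (sqrt_iter n x)) (Y (Y x)).
    move=> e e0; have e20 : 0 < e / 2 by rewrite divr_gt0.
    have [N /(_ _ (leq_trans (leq_maxl _ _) _)) Nu] := YP x _ e20.
    have [N' /(_ _ (leq_trans (leq_maxr _ _) _)) Nw] := YP (Y x) _ e20.
    exists (maxn N N') => n Nn; have := Nu _ _ Nn; have := Nw _ _ Nn.
    have := hnBB (sqrt_iter n (sqrt_iter n x)) (sqrt_iter n (Y x)) (Y (Y x)).
    rewrite -rsymB; last exact: sqrt_iter_sym.
    have := Yn1 n (sqrt_iter n x - Y x); lra.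
  have L1 := lim_toZ 2%:C (lim_toS (YP x)).
  have L2 := lim_toD (lim_to_cst (X x)) YY.
  apply: lim_to_unique L2; move: L1; congr lim_to.
  apply: funext => n /=; rewrite scalerA -rmorphM mulfV ?pnatr_eq0//.
  by rewrite rmorph1 scale1r.
- move=> C sC CX x; apply: rip_inj => z; rewrite sC.
  apply: lim_to_rip_eq (YP x) (YP (C x)) _ => n.
  by rewrite -sC sqrt_iter_comm.
Qed.

End SquareRoot.

(** Orthogonal projections of the underlying real Hilbert space; [rsym] already forces additivity
    and real homogeneity. *)
Definition is_proj P := rsym P /\ forall x, P (P x) = P x.

Lemma proj_onto (M : set H) : M 0 ->
  (forall (k : R) u v, M u -> M v -> M (k%:C *: u + v)) ->
  (forall u l, (forall n, M (u n)) -> lim_to u l -> M l) ->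
  exists P, [/\ is_proj P, forall x, M (P x), forall x, M x -> P x = x
    & forall x u, M u -> rip (x - P x) u = 0].
Proof.
move=> M0 Ml Mc.
have /choice[P PP] : forall x, exists p, M p /\ forall u, M u -> rip (x - p) u = 0.
  by move=> x; have [p] := projection_exists x M0 Ml Mc; exists p.
have PM x : M (P x) by have [] := PP x.
have Po x u : M u -> rip (x - P x) u = 0 by have [_] := PP x; apply.
have Pid x : M x -> P x = x.
  move=> Mx; apply/esym/subr0_eq/eqP; rewrite -nn_eq0 /nn Po//.
  by have := Ml (-1) _ _ (PM x) Mx; rewrite rmorphN1 scaleN1r addrC.
exists P; split=> //; split=> [x y|x]; last exact: Pid.
have := Po x _ (PM y); have := Po y _ (PM x).
by rewrite !ripE (ripC y) (ripC (P y)); lra.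
Qed.

(** The last hypothesis says that the range of [P] is invariant under [B]; by symmetry its
    orthogonal complement is invariant too. *)
Lemma is_proj_comm P B : is_proj P -> rsym B ->
  (forall x, P (B (P x)) = B (P x)) -> forall x, P (B x) = B (P x).
Proof.
move=> [sP _] sB PBP x; apply: rip_inj => y.
by rewrite -PBP !sP !sB sP PBP.
Qed.

(* [P] is the projection onto the kernel of [|B| - B], and [|B|] is a multiple
   of [1 - Y] where [Y] is the iterated solution for [X = 1 - B^2 / N^2]. *)
Lemma sign_splitting B : rsym B -> exists P,
  [/\ is_proj P, forall x, P (B x) = B (P x),
      forall x, 0 <= rip (B (P x)) (P x),
      forall x, rip (B (x - P x)) (x - P x) <= 0
    & forall x, B x = 0 -> P x = x].
Proof.
move=> sB; have [N N0 BN] := hellinger_toeplitz sB.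
pose K x := N^-1%:C *: B x.
have BK x : B x = N%:C *: K x.
  by rewrite scalerA -rmorphM mulfV ?gt_eqF// rmorph1 scale1r.
have sK : rsym K by move=> x y; rewrite !ripE sB.
have K1 x : hn (K x) <= hn x.
  by rewrite hnZ gtr0_norm ?invr_gt0// ler_pdivrMl// BN.
have K0 x : B x = 0 -> K x = 0 by rewrite /K => ->; rewrite scaler0.
clearbody K.
pose X x := x - K (K x).
have sX : rsym X by move=> x y; rewrite /X !ripE !sK.
have X1 x : hn (X x) <= hn x.
  rewrite hn_le nnB -sK -/(nn (K x)).
  have := K1 (K x); rewrite hn_le; have := nn_ge0 (K x); lra.
have [Y [sY Y1 YE Yc]] := sqrt_exists sX X1.
pose A x := x - Y x.
have sA : rsym A by move=> x y; rewrite /A !ripE sY.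
have A_ge0 x : 0 <= rip (A x) x.
  rewrite /A !ripE subr_ge0 (le_trans (ler_norm _))// (le_trans (rip_le _ _))//.
  by rewrite -/(nn x) -sqr_hn expr2 ler_wpM2r ?hn_ge0.
have AA x : A (A x) = K (K x).
  have := YE x; rewrite /A (rsymB _ _ sY) mulrS rmorphD rmorph1 scalerDl !scale1r.
  rewrite /X => /esym/(canRL (addKr _)) ->.
  by apply: rip_inj => z; rewrite !ripE; ring.
have KX x : K (X x) = X (K x) by rewrite /X rsymB.
have AK x : A (K x) = K (A x) by rewrite /A (rsymB _ _ sK) (Yc K sK KX).
pose M : set H := [set x | A x = K x].
clearbody A.
have [|||P [prP PM Pid Po]] := @proj_onto M.
- by rewrite /M /= !rsym0.
- move=> k u v; rewrite /M /= => Mu Mv.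
  by rewrite !(rsymD _ _ sA) !(rsymD _ _ sK) !(rsymZ _ _ sA) !(rsymZ _ _ sK) Mu Mv.
- move=> u l Mu ul; apply: rip_inj => z; rewrite sA sK.
  by apply: (lim_to_rip_eq ul ul) => n; rewrite -sA -sK Mu.
exists P; split => //.
- apply: is_proj_comm => // x; apply: Pid; rewrite /M /= !BK.
  by rewrite (rsymZ _ _ sA) (rsymZ _ _ sK) AK; have /= -> := PM x.
- by move=> x; have /= eA := PM x; rewrite BK ripZl -eA mulr_ge0 ?(ltW N0).
- move=> x; set z := x - P x.
  (* From A^2 = K^2 and A K = K A follows A (A + K) = K (A + K), so A + K maps into [M]. As [z] is
     orthogonal to [M], symmetry gives (A + K) z = 0. *)
  suff Kz : K z = - A z.
    by rewrite BK ripZl Kz ripNl mulrN oppr_le0 mulr_ge0 ?(ltW N0).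
  apply: rip_inj => w; apply/subr0_eq; rewrite !ripE sK sA opprK -ripDr.
  by apply: Po; rewrite /M /= (rsymD _ _ sA) (rsymD _ _ sK) AK AA addrC.
- move=> x Bx0; have Kx0 := K0 x Bx0.
  apply: Pid; rewrite /M /= Kx0; apply/eqP.
  by rewrite -nn_eq0 /nn sA AA Kx0 rsym0// rip0r.
Qed.

End BoundedSymmetric.

(** * Reducing projections of a self-adjoint operator *)

Section OperatorAlgebra.
Local Open Scope complex_scope.
Context {R : realType} {H : hilbertType R}.
Implicit Types (T : operator H) (x y z : H) (c : R[i]).

Lemma domD T x y : dom T x -> dom T y -> dom T (x + y).
Proof. by move=> Dx Dy; rewrite -[x]scale1r; apply: dom_linear. Qed.

Lemma domZ T c x : dom T x -> dom T (c *: x).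
Proof. by move=> Dx; rewrite -[c *: x]addr0; apply: dom_linear => //; exact: dom0. Qed.

Lemma domB T x y : dom T x -> dom T y -> dom T (x - y).
Proof. by move=> Dx Dy; rewrite -scaleN1r; apply: domD => //; exact: domZ. Qed.

Lemma opD T x y : dom T x -> dom T y -> T (x + y) = T x + T y.
Proof. by move=> Dx Dy; have := op_linear 1 Dx Dy; rewrite !scale1r. Qed.

Lemma op0 T : T 0 = 0.
Proof.
have := opD (dom0 T) (dom0 T); rewrite addr0 => /esym/eqP.
by rewrite -subr_eq0 addrK => /eqP.
Qed.

Lemma opZ T c x : dom T x -> T (c *: x) = c *: T x.
Proof.
by move=> Dx; have := op_linear c Dx (dom0 T); rewrite op0 !addr0.
Qed.

Lemma opB T x y : dom T x -> dom T y -> T (x - y) = T x - T y.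
Proof.
move=> Dx Dy; have DNy : dom T (-1 *: y) by exact: domZ.
by rewrite -scaleN1r -[- T y]scaleN1r -opZ// -opD.
Qed.

Lemma rip_i x y : rip ('i%C *: x) y = - rip x ('i%C *: y).
Proof. by rewrite /rip innerZl innerZr; case: (inner x y) => u v /=; ring. Qed.

Definition shiftT T (mu : R) x := T x - mu%:C *: x.

Lemma shiftTD T mu x y : dom T x -> dom T y ->
  shiftT T mu (x + y) = shiftT T mu x + shiftT T mu y.
Proof. by move=> Dx Dy; rewrite /shiftT opD// scalerDr opprD addrACA. Qed.

Lemma shiftTZ T mu c x : dom T x -> shiftT T mu (c *: x) = c *: shiftT T mu x.
Proof. by move=> Dx; rewrite /shiftT opZ// scalerBr !scalerA mulrC. Qed.

Lemma shiftTB T mu x y : dom T x -> dom T y ->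
  shiftT T mu (x - y) = shiftT T mu x - shiftT T mu y.
Proof.
move=> Dx Dy; have DNy : dom T (-1 *: y) by exact: domZ.
by rewrite -scaleN1r -[- shiftT T mu y]scaleN1r -shiftTZ// -shiftTD.
Qed.

Lemma rip_shiftT T mu x y : rip (shiftT T mu x) y = rip (T x) y - mu * rip x y.
Proof. by rewrite /shiftT !ripE. Qed.

(** Everything is required only along the line through [x] in direction [y], so that [L] may be
    meaningful on a domain only. *)
Lemma psd_cauchy_schwarz (L : H -> H) x y :
  (forall t : R, L (x + t%:C *: y) = L x + t%:C *: L y) ->
  rip (L x) y = rip x (L y) ->
  (forall t : R, 0 <= rip (L (x + t%:C *: y)) (x + t%:C *: y)) ->
  0 <= rip (L y) y ->
  rip (L x) y ^+ 2 <= rip (L x) x * rip (L y) y.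
Proof.
move=> Ll Ls Lp Ly; apply: quadratic_ge0 => // t.
have := Lp t; rewrite Ll !ripE (ripC (L y) x) -Ls; lra.
Qed.

End OperatorAlgebra.

Section Reduction.
Local Open Scope complex_scope.
Context {R : realType} {H : hilbertType R} (T : operator H).
Hypothesis saT : self_adjoint T.
Implicit Types (x y z : H) (P Q : H -> H) (s : R).

Lemma sa_inner x y : dom T x -> dom T y -> inner (T x) y = inner x (T y).
Proof.
move=> Dx Dy; have [_ eT] := saT.
have : op_graph T (y, T y) by [].
by rewrite -eT; apply.
Qed.

Lemma sa_rip x y : dom T x -> dom T y -> rip (T x) y = rip x (T y).
Proof. by move=> Dx Dy; rewrite /rip sa_inner. Qed.

Lemma shiftT_rip mu x y : dom T x -> dom T y ->
  rip (shiftT T mu x) y = rip x (shiftT T mu y).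
Proof. by move=> Dx Dy; rewrite (ripC x) !rip_shiftT sa_rip// (ripC x (T y)) (ripC x y). Qed.

(** Real parts suffice: testing with i x recovers the imaginary part of the adjoint identity. *)
Lemma sa_dom y z : (forall x, dom T x -> rip (T x) y = rip x z) ->
  dom T y /\ T y = z.
Proof.
move=> h; have [_ eT] := saT.
have : adjoint_graph T (y, z).
  move=> x Dx /=; have := h _ (domZ 'i%C Dx).
  by rewrite opZ// !rip_i => /oppr_inj e; rewrite !innerE h// e.
by rewrite eT => -[/= Dy ->].
Qed.

Definition reducing P :=
  is_proj P /\ forall x, dom T x -> dom T (P x) /\ T (P x) = P (T x).

Lemma reducing_shift P mu x : reducing P -> dom T x ->
  P (shiftT T mu x) = shiftT T mu (P x).
Proof.
by move=> [[sP _] rP] Dx; rewrite /shiftT (rsymB _ _ sP) (rsymZ _ _ sP); have [_ ->] := rP x Dx.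
Qed.

Lemma lim_hcauchy (u : nat -> H) l : lim_to u l -> hcauchy u.
Proof.
move=> ul e e0; have e20 : 0 < e / 2 by rewrite divr_gt0.
have [N Nu] := ul _ e20; exists N => m n Nm Nn.
have := hnBB (u m) l (u n); rewrite (hnBC l); have := Nu _ Nm; have := Nu _ Nn; lra.
Qed.

(** Closed range argument inside the range of [P]. The lower bound makes the set of attained values
    closed. The part of [P y] orthogonal to it lies in the kernel of T - mu by self-adjointness, and
    the lower bound makes it vanish. *)
Lemma reducing_solve P mu (e : R) : reducing P -> 0 < e ->
  (forall x, dom T x -> P x = x -> e * hn x <= hn (shiftT T mu x)) ->
  forall y, exists x, [/\ dom T x, P x = x & shiftT T mu x = P y].
Proof.
move=> rP e0 lb y; have [[sP idP] TP] := rP.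
pose M : set H := [set v | exists x, [/\ dom T x, P x = x & shiftT T mu x = v]].
have PM v : M v -> P v = v.
  by move=> [x [Dx Px <-]]; rewrite reducing_shift// Px.
have [|k u v [x [Dx Px <-]] [x' [Dx' Px' <-]]|u l Mu ul|p [x [Dx Px xp]] hp] :=
  @projection_exists _ _ M (P y).
- exists 0; rewrite rsym0//; split => //; first exact: dom0.
  by rewrite /shiftT op0 scaler0 subrr.
- exists (k%:C *: x + x'); rewrite (rsymD _ _ sP) (rsymZ _ _ sP) Px Px'; split => //.
    by apply: dom_linear.
  by rewrite shiftTD ?shiftTZ//; exact: domZ.
- have [w wP] := choice Mu.
  have [x wx] : exists x, lim_to w x.
    apply: hcauchy_lim => d d0.
    have [N Nu] := lim_hcauchy ul (mulr_gt0 e0 d0).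
    exists N => m n Nm Nn; have := Nu m n Nm Nn.
    have [Dm Pm <-] := wP m; have [Dn Pn <-] := wP n.
    rewrite -shiftTB// => h; rewrite -(ler_pM2l e0); apply: le_trans h.
    by apply: lb; [exact: domB|rewrite rsymB// Pm Pn].
  have [|Dx Tx] := @sa_dom x (l + mu%:C *: x).
    move=> v Dv; rewrite ripC (ripC v).
    apply: (lim_to_rip_eq wx (lim_toD ul (lim_toZ mu%:C wx))) => n.
    have [Dn _ <-] := wP n.
    by rewrite /shiftT subrK sa_rip.
  exists x; split=> //; last by rewrite /shiftT Tx addrK.
  apply: rip_inj => v; rewrite sP; apply: (lim_to_rip_eq wx wx) => n.
  by have [_ Pn _] := wP n; rewrite -sP Pn.
set z := P y - p.
have Pz : P z = z.
  by rewrite /z (rsymB _ _ sP) idP (PM p)//; exists x.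
have [|Dz Tz] := @sa_dom z (mu%:C *: z).
  move=> w Dw; have [DPw TPw] := TP w Dw.
  rewrite -{1}Pz -sP -TPw ripZr -{2}Pz -sP; apply/subr0_eq.
  rewrite -rip_shiftT ripC; apply: hp; exists (P w); split => //.
have hz : e * hn z <= 0.
  by have := lb z Dz Pz; rewrite /shiftT Tz subrr hn0.
have /subr0_eq Pyp : z = 0.
  by apply/eqP; rewrite -hn_eq0 eq_le hn_ge0 andbT -(pmulr_rle0 _ e0).
by exists x; rewrite Pyp.
Qed.

End Reduction.

(** * Form bounds from relative bounds *)

Section RelativeBound.
Local Open Scope complex_scope.
Context {R : realType} {H : hilbertType R} (T : operator H).
Hypothesis saT : self_adjoint T.
Implicit Types (x y z : H) (P Q : H -> H) (s : R).

(** If |S 1| exceeded S 0 by d > 0, induction on k would give |S (2^k)| >= S 0 + (k + 1) d, against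
    boundedness. *)
Lemma doubling_bounded (S : nat -> R) (K : R) :
  (forall n, S n ^+ 2 <= S n.*2 * S 0%N) -> (forall n, `|S n| <= K) -> 0 <= S 0%N ->
  `|S 1%N| <= S 0%N.
Proof.
move=> S2 SK S0; rewrite leNgt; apply/negP => S01.
have S0_gt0 : 0 < S 0%N.
  rewrite lt_neqAle S0 andbT; apply: contraTneq S01 => S00.
  rewrite -S00 -leNgt normr_le0 -sqrf_eq0 eq_le sqr_ge0 andbT.
  by have := S2 1%N; rewrite -S00 mulr0.
pose d := (`|S 1%N| - S 0%N).
have d_gt0 : 0 < d by rewrite subr_gt0.
have grow k : S 0%N + k.+1%:R * d <= `|S (2 ^ k)%N|.
  elim: k => [|k IH]; first by rewrite expn0 mul1r /d addrC subrK.
  have := S2 (2 ^ k)%N; rewrite -mul2n -expnS -[S (2 ^ k)%N ^+ 2]real_normK ?num_real// => h.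
  have {}h : `|S (2 ^ k)%N| ^+ 2 <= `|S (2 ^ k.+1)%N| * S 0%N.
    apply: le_trans h _; apply: ler_wpM2r => //; exact: ler_norm.
  rewrite -(ler_pM2r S0_gt0); apply: le_trans h.
  have : (S 0%N + k.+1%:R * d) ^+ 2 <= `|S (2 ^ k)%N| ^+ 2.
    rewrite ler_sqr ?nnegrE// addr_ge0// mulr_ge0// ltW//.
  apply: le_trans.
  have : 0 <= k%:R * d * S 0%N by rewrite !mulr_ge0// ltW.
  have : 0 <= (k.+1%:R * d) ^+ 2 by rewrite sqr_ge0.
  rewrite -[k.+2]addn2 -[k.+1]addn1 !natrD; nra.
have := grow (Num.truncn (K / d)); apply/negP; rewrite -ltNge.
have : K / d < (Num.truncn (K / d)).+1%:R by rewrite truncnS_gt.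
rewrite ltr_pdivrMr//; have := SK (2 ^ Num.truncn (K / d))%N; lra.
Qed.

Lemma positive_lower_bound P mu s (e : R) : s ^+ 2 = 1 ->
  (forall x, dom T x -> P x = x -> e * nn x <= s * rip (shiftT T mu x) x) ->
  forall x, dom T x -> P x = x -> e * hn x <= hn (shiftT T mu x).
Proof.
move=> s2 h x Dx Px.
have [->|x0] := eqVneq x 0; first by rewrite hn0 mulr0 hn_ge0.
have hx : 0 < hn x by rewrite lt_neqAle hn_ge0 andbT eq_sym hn_eq0.
rewrite -(ler_pM2r hx) -mulrA -expr2 sqr_hn (le_trans (h x Dx Px))//.
rewrite (le_trans (ler_norm _))// normrM (_ : `|s| = 1) ?mul1r ?rip_le//.
by apply/eqP; rewrite -sqrp_eq1 ?real_normK ?num_real// s2.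
Qed.

(* Reid's argument: the iterates [x_{n+1} = G^-1 P A x_n], where
   [G = s (T - mu)], satisfy [g(x_n, x_k) = g(x_{n+k}, x_0)] for the form
   [g] of [G], so that Cauchy-Schwarz makes [g(x_n, x_0)] log-convex along
   doubling; it is also bounded. *)
Lemma reid_inequality P mu s (e : R) (A : H -> H) :
  reducing T P -> s ^+ 2 = 1 -> 0 < e ->
  (forall x y, dom T x -> dom T y -> rip (A x) y = rip x (A y)) ->
  (forall x, dom T x -> P x = x -> e * nn x <= s * rip (shiftT T mu x) x) ->
  (forall x, dom T x -> P x = x -> nn (A x) <= nn (shiftT T mu x)) ->
  forall x, dom T x -> P x = x -> `|rip (A x) x| <= s * rip (shiftT T mu x) x.
Proof.
move=> rP s2 e0 sA pos AG x Dx Px; have [[sP idP] TP] := rP.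
have lb := positive_lower_bound s2 pos.
have /choice[f fP] : forall y, exists z,
    [/\ dom T z, P z = z & shiftT T mu z = P (s%:C *: A y)].
  by move=> y; apply: (reducing_solve saT rP e0 lb).
pose u n := iter n f x.
have Du n : dom T (u n) by case: n => [//|n]; rewrite /u iterS; have [] := fP (u n).
have Pu n : P (u n) = u n by case: n => [//|n]; rewrite /u iterS; have [] := fP (u n).
have Su n : shiftT T mu (u n.+1) = s%:C *: P (A (u n)).
  by have [_ _ ->] := fP (u n); rewrite (rsymZ _ _ sP).
pose g y z := s * rip (shiftT T mu y) z.
have gC y z : dom T y -> dom T z -> g y z = g z y.
  by move=> Dy Dz; rewrite /g shiftT_rip// ripC.
have gS n k : g (u n.+1) (u k) = rip (A (u n)) (u k).
  by rewrite /g Su ripZl mulrA -expr2 s2 mul1r sP Pu.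
have gD n k : g (u n) (u k) = g (u (n + k)%N) (u 0%N).
  elim: k n => [|k IH] n; first by rewrite addn0.
  by rewrite addnS -addSn -IH gS gC// gS sA// ripC.
pose S n := g (u n) (u 0%N).
have s_norm : `|s| = 1 by apply/eqP; rewrite -sqrp_eq1 ?real_normK ?num_real// s2.
have g_ge0 y : dom T y -> P y = y -> 0 <= g y y.
  by move=> Dy Py; apply: le_trans (pos y Dy Py); rewrite mulr_ge0 ?nn_ge0// ltW.
(* The norm domination enters here: G u_(n+1) = P A u_n is no longer than A u_n, hence than G u_n.
   This is what bounds [S]. *)
have hG n : hn (shiftT T mu (u n)) <= hn (shiftT T mu x).
  elim: n => [//|n]; apply: le_trans.
  apply: (@le_trans _ _ (hn (A (u n)))); last by rewrite hn_le AG.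
  rewrite hn_le Su nnZ s2 mul1r.
  have := nn_ge0 (A (u n) - P (A (u n))); rewrite nnB.
  have -> : rip (A (u n)) (P (A (u n))) = nn (P (A (u n))) by rewrite /nn sP idP.
  lra.
(* [S 0] is g (x, x) and [S 1] is (A x, x). *)
suff : `|S 1%N| <= S 0%N by rewrite /S gS.
apply: (@doubling_bounded S (hn (shiftT T mu x) * hn x)).
- move=> n; rewrite /S -addnn -gD /g !mulrA.
  have -> : forall p q : R, s * p * s * q = s ^+ 2 * (p * q) by move=> p q; ring.
  rewrite exprMn s2 !mul1r.
  suff : (s * rip (shiftT T mu (u n)) (u 0%N)) ^+ 2 <=
         (s * rip (shiftT T mu (u n)) (u n)) * (s * rip (shiftT T mu (u 0%N)) (u 0%N)).
    have -> : forall p q : R, s * p * (s * q) = s ^+ 2 * (p * q) by move=> p q; ring.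
    by rewrite exprMn s2 !mul1r.
  rewrite -!(ripZl s); apply: (@psd_cauchy_schwarz _ _ (fun y => s%:C *: shiftT T mu y)).
  + move=> t; rewrite shiftTD ?shiftTZ ?scalerDr//; last exact: domZ.
    by rewrite !scalerA (mulrC s%:C).
  + by rewrite ripZl ripZr shiftT_rip.
  + move=> t; rewrite ripZl; apply: g_ge0; first by apply/domD/domZ.
    by rewrite (rsymD _ _ sP) (rsymZ _ _ sP) !Pu.
  + by rewrite ripZl; apply: g_ge0.
- move=> n; rewrite /S /g normrM s_norm mul1r (le_trans (rip_le _ _))//.
  by rewrite ler_wpM2r ?hn_ge0.
- exact: g_ge0.
Qed.

(** Let p = s ((T - t0) x, x) >= 0, let f be the square root, and G = s (T - t0) + f + e. Then ||G
    x||^2 = ||(T - t0) x||^2 + 2 (f + e) p + (f + e)^2 ||x||^2, while the relative bound equals b^2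
    ||(T - t0) x||^2 + 2 b^2 s t0 p + f^2 ||x||^2. The coefficients compare one by one, since b < 1
    and b |t0| <= f. Reid's inequality then gives |(A x, x)| <= p + (f + e) ||x||^2; e > 0 keeps G
    strictly positive and is arbitrary. *)
Lemma relative_form_bound P t0 s (a b : R) (A : H -> H) :
  reducing T P -> s ^+ 2 = 1 -> b < 1 -> 0 <= b ->
  (forall x y, dom T x -> dom T y -> rip (A x) y = rip x (A y)) ->
  (forall x, dom T x -> nn (A x) <= a ^+ 2 * nn x + b ^+ 2 * nn (T x)) ->
  (forall x, dom T x -> P x = x -> 0 <= s * rip (shiftT T t0 x) x) ->
  forall x, dom T x -> P x = x ->
    - (Num.sqrt (a ^+ 2 + b ^+ 2 * t0 ^+ 2) * nn x) <=
      s * (rip (T x) x + rip (A x) x - t0 * nn x).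
Proof.
move=> rP s2 b1 b0 sA Ab pos x Dx Px.
set f := Num.sqrt _.
have f0 : 0 <= f by exact: sqrtr_ge0.
have f2 : f ^+ 2 = a ^+ 2 + b ^+ 2 * t0 ^+ 2.
  by rewrite sqr_sqrtr// addr_ge0 ?sqr_ge0// mulr_ge0 ?sqr_ge0.
have s1 : s = 1 \/ s = -1.
  by move/eqP: s2; rewrite sqrf_eq1 => /orP[] /eqP; [left|right].
have ft : b * `|t0| <= f.
  rewrite -ler_sqr ?nnegrE ?mulr_ge0// exprMn real_normK ?num_real// f2.
  by rewrite lerDr sqr_ge0.
have shift_mu mu y : s * rip (shiftT T (t0 - s * mu) y) y = s * rip (shiftT T t0 y) y + mu * nn y.
  rewrite !rip_shiftT -/(nn y) -[in RHS](mul1r (mu * _)) -s2; ring.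
apply/ler_addgt0Pl => d d0.
pose e := d / (nn x + 1).
have nx1 : 0 < nn x + 1 by rewrite ltr_wpDl ?nn_ge0.
have e0 : 0 < e by rewrite divr_gt0.
have := @reid_inequality P (t0 - s * (f + e)) s e A rP s2 e0 sA.
move=> /(_ _ _ x Dx Px); rewrite shift_mu => h.
have {h} : `|rip (A x) x| <= s * rip (shiftT T t0 x) x + (f + e) * nn x.
  apply: h => y Dy Py.
    rewrite shift_mu mulrDl; have := pos y Dy Py.
    have : 0 <= f * nn y by rewrite mulr_ge0 ?nn_ge0.
    lra.
  apply: le_trans (Ab y Dy) _.
  have := pos y Dy Py; set p := s * _ => p0.
  have -> : nn (shiftT T (t0 - s * (f + e)) y) =
      nn (shiftT T t0 y) + 2 * (f + e) * p + (f + e) ^+ 2 * nn y.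
    have -> : shiftT T (t0 - s * (f + e)) y = shiftT T t0 y + (s * (f + e))%:C *: y.
      by rewrite /shiftT rmorphB scalerBl opprB addrA addrAC.
    rewrite nnD nnZ ripZr exprMn s2 mul1r /p; ring.
  have -> : nn (T y) = nn (shiftT T t0 y) + 2 * (s * t0) * p + t0 ^+ 2 * nn y.
    have -> : T y = shiftT T t0 y + t0%:C *: y by rewrite /shiftT subrK.
    rewrite nnD nnZ ripZr /p.
    have -> : forall q : R, 2 * (s * t0) * (s * q) = s ^+ 2 * (2 * (t0 * q)) by move=> q; ring.
    by rewrite s2 mul1r.
  have nS := nn_ge0 (shiftT T t0 y); have ny := nn_ge0 y.
  have b2 : b ^+ 2 <= b by rewrite expr2 ler_piMr// ltW.
  have t1 : b ^+ 2 * nn (shiftT T t0 y) <= nn (shiftT T t0 y).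
    by rewrite ler_piMl// (le_trans b2)// ltW.
  have t2 : b ^+ 2 * (s * t0) <= f + e.
    have : s * t0 <= `|t0|.
      by case: s1 => ->; rewrite ?mul1r ?mulN1r ?ler_norm// -normrN ler_norm.
    have : b ^+ 2 * `|t0| <= b * `|t0| by rewrite ler_wpM2r.
    have := sqr_ge0 b; have := normr_ge0 t0; move: ft e0; nra.
  have t3 : b ^+ 2 * (s * t0) * p <= (f + e) * p by rewrite ler_wpM2r.
  have t4 : f ^+ 2 * nn y <= (f + e) ^+ 2 * nn y.
    by rewrite ler_wpM2r// ler_sqr ?nnegrE// ?addr_ge0// ?(ltW e0)// lerDl ltW.
  move: t4; rewrite f2; nra.
have : e * nn x <= d.
  by rewrite /e mulrAC ler_pdivrMr// ler_pM2l// lerDl.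
have := ler_norm (rip (A x) x); have := ler_norm (- rip (A x) x); rewrite normrN.
rewrite rip_shiftT -/(nn x).
by case: s1 => ->; rewrite ?mulN1r ?mul1r; lra.
Qed.

End RelativeBound.

(** * Spectral gaps *)

Section SpectralGap.
Local Open Scope complex_scope.
Context {R : realType} {H : hilbertType R} (T : operator H).
Hypothesis saT : self_adjoint T.
Implicit Types (x y z : H) (P Q : H -> H) (s : R).

Lemma reducing_sub P Q : reducing T P -> reducing T Q ->
  (forall x, P (Q x) = Q x) -> reducing T (fun x => P x - Q x).
Proof.
move=> [[sP iP] TP] [[sQ iQ] TQ] PQ.
have QP x : Q (P x) = Q x by apply: rip_inj => z; rewrite sQ sP PQ sQ.
split; [split|].
- by move=> x y; rewrite !ripE sP sQ.
- by move=> x; rewrite (rsymB _ _ sP) (rsymB _ _ sQ) iP iQ PQ QP subrr subr0.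
- move=> x Dx; have [DP TPx] := TP x Dx; have [DQ TQx] := TQ x Dx.
  by split; [exact: domB|rewrite opB// TPx TQx].
Qed.

(** The closed range admits a projection of [y]. The residual is orthogonal to the range, so by
    self-adjointness it lies in the kernel of T - mu; it is then orthogonal to [y] as well and
    vanishes. *)
Lemma fredholm_solve mu : fredholm (op_shift T mu%:C) -> forall y,
  (forall x, dom T x -> shiftT T mu x = 0 -> rip y x = 0) ->
  exists2 x, dom T x & shiftT T mu x = y.
Proof.
move=> [_ clran _ _] y hy.
have shE x : op_shift T mu%:C x = shiftT T mu x by rewrite /shiftT /= scaleNr.
pose M := op_ran (op_shift T mu%:C).
have [||u l Mu|p Mp hp] := @projection_exists _ _ M y.
- by exists 0; [split; [exact: dom0|]|rewrite op0].
- move=> k _ _ [u Du <-] [v Dv <-]; exists (k%:C *: u + v); last by rewrite op_linear.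
  exact: dom_linear.
- exact: closed_lim_to.
have [|Dz Tz] := @sa_dom _ _ _ saT (y - p) (mu%:C *: (y - p)).
  move=> w Dw; apply/subr0_eq.
  rewrite ripZr -rip_shiftT ripC; apply: hp; exists w; first by split.
  exact: shE.
have z0 : y - p = 0.
  apply/eqP; rewrite -nn_eq0 /nn ripDr ripNr (hp p Mp) subr0 ripC.
  by rewrite hy// /shiftT Tz subrr.
case: Mp => x [Dx _] e; exists x => //; rewrite -shE e.
by apply/esym/subr0_eq.
Qed.

(* A solution operator of [T - mu] on the range of [Q] is symmetric and
   everywhere defined, hence bounded. *)
Lemma solution_operator Q mu : reducing T Q ->
  (forall y, exists x, [/\ dom T x, Q x = x & shiftT T mu x = Q y]) ->
  (forall x, dom T x -> Q x = x -> shiftT T mu x = 0 -> x = 0) ->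
  exists B, [/\ rsym B, forall y, dom T (B y), forall y, Q (B y) = B y,
    forall y, shiftT T mu (B y) = Q y &
    forall x, dom T x -> Q x = x -> B (shiftT T mu x) = x].
Proof.
move=> rQ /choice[B BP] inj; have [[sQ iQ] TQ] := rQ.
have DB y : dom T (B y) by have [] := BP y.
have QB y : Q (B y) = B y by have [] := BP y.
have TB y : shiftT T mu (B y) = Q y by have [] := BP y.
exists B; split => //.
- move=> x y; rewrite -{1}QB sQ -TB -shiftT_rip// TB sQ QB//.
- move=> x Dx Qx; apply/subr0_eq/inj; first exact: domB.
    by rewrite (rsymB _ _ sQ) QB Qx.
  by rewrite shiftTB// TB reducing_shift// Qx subrr.
Qed.

Variables (al be : R).
Hypothesis al_be : al < be.
Variable Q : H -> H.
Hypothesis rQ : reducing T Q.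
Hypothesis solveQ : forall mu, al < mu < be ->
  forall y, exists x, [/\ dom T x, Q x = x & shiftT T mu x = Q y].
Hypothesis injQ : forall mu, al < mu < be ->
  forall x, dom T x -> Q x = x -> shiftT T mu x = 0 -> x = 0.

Let c := (al + be) / 2.
Let r := (be - al) / 2.

(** Cauchy-Schwarz for the form of s (T - g) at [x] and y = (T - g)^-1 x bounds ||x||^4 by the form
    at [x] times M ||x||^2, where M bounds the inverse. Hence d = 1 / M. *)
Lemma gap_form_improve P s g : reducing T P -> (forall x, P x = x -> Q x = x) ->
  s ^+ 2 = 1 -> al < g < be ->
  (forall x, dom T x -> P x = x -> 0 <= s * rip (shiftT T g x) x) ->
  exists2 d, 0 < d &
    forall x, dom T x -> P x = x -> d * nn x <= s * rip (shiftT T g x) x.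
Proof.
move=> rP PQ s2 gI pos; have [[sP iP] TP] := rP.
have [B [sB DB QB TB _]] := solution_operator rQ (solveQ gI) (injQ gI).
have [M M0 BM] := hellinger_toeplitz sB.
exists M^-1 => [|x Dx Px]; first by rewrite invr_gt0.
rewrite ler_pdivrMl//.
pose y := P (B x).
have Dy : dom T y by have [] := TP _ (DB x).
have Py : P y = y by rewrite /y iP.
have Ty : shiftT T g y = x by rewrite /y -reducing_shift// TB PQ// Px.
have : (s * rip (shiftT T g x) y) ^+ 2 <=
       (s * rip (shiftT T g x) x) * (s * rip (shiftT T g y) y).
  rewrite -!(ripZl s); apply: (@psd_cauchy_schwarz _ _ (fun y => s%:C *: shiftT T g y)).
  + move=> t; rewrite shiftTD ?shiftTZ ?scalerDr//; last exact: domZ.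
    by rewrite !scalerA (mulrC s%:C).
  + by rewrite ripZl ripZr shiftT_rip.
  + move=> t; rewrite ripZl; apply: pos; first by apply/domD/domZ.
    by rewrite (rsymD _ _ sP) (rsymZ _ _ sP) Px Py.
  + by rewrite ripZl; apply: pos.
rewrite shiftT_rip// Ty -/(nn x) exprMn s2 mul1r.
have gx := pos x Dx Px; set q := s * rip _ x in gx *.
have : s * rip x y <= M * nn x.
  have s_norm : `|s| = 1 by apply/eqP; rewrite -sqrp_eq1 ?real_normK ?num_real// s2.
  rewrite (le_trans (ler_norm _))// normrM s_norm mul1r (le_trans (rip_le _ _))//.
  rewrite -sqr_hn expr2 mulrCA ler_wpM2l ?hn_ge0//.
  apply: le_trans (BM x); rewrite hn_le.
  have := nn_ge0 (B x - y); rewrite nnB.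
  have -> : rip (B x) y = nn y by rewrite /nn /y sP iP.
  lra.
move=> h1 h2.
have h3 : nn x ^+ 2 <= q * (M * nn x).
  by apply: le_trans h2 _; rewrite ler_wpM2l.
have [nx0|nx0] := eqVneq (nn x) 0; first by rewrite nx0 mulr_ge0// ltW.
have nx1 : 0 < nn x by rewrite lt_neqAle nn_ge0 andbT eq_sym.
by rewrite -(ler_pM2r nx1) -expr2 (le_trans h3)// mulrA (mulrC q).
Qed.

(** The best constant t in place of [r] is attained. If it were below the half-width [r], the point
    c + s t would still lie in the gap, and the form could be improved there. *)
Lemma gap_form P s : reducing T P -> (forall x, P x = x -> Q x = x) ->
  s ^+ 2 = 1 ->
  (forall x, dom T x -> P x = x -> 0 <= s * rip (shiftT T c x) x) ->
  forall x, dom T x -> P x = x -> r * nn x <= s * rip (shiftT T c x) x.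
Proof.
move=> rP PQ s2 pos.
have r0 : 0 < r by rewrite divr_gt0// subr_gt0.
pose S : set R := [set t | 0 <= t <= r /\
  forall x, dom T x -> P x = x -> t * nn x <= s * rip (shiftT T c x) x].
have S0 : S 0 by split=> [|x Dx Px]; rewrite ?lexx ?(ltW r0)// mul0r pos.
have supS : has_sup S by split; [exists 0|exists r => t [/andP[]]].
have s0 : 0 <= sup S by apply: sup_upper_bound.
have supr : sup S <= r by apply: ge_sup => [|t [/andP[]]//]; exists 0.
have Ssup : forall x, dom T x -> P x = x -> sup S * nn x <= s * rip (shiftT T c x) x.
  move=> x Dx Px; have [->|x0] := eqVneq x 0; first by rewrite nn0 rip0r !mulr0.
  rewrite -ler_pdivlMr ?nn_gt0//; apply: ge_sup; first by exists 0.
  by move=> t [_ /(_ x Dx Px)]; rewrite ler_pdivlMr ?nn_gt0.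
have [sr|] := ltP (sup S) r; last first.
  by move=> rs x Dx Px; rewrite (le_trans _ (Ssup x Dx Px))// ler_wpM2r ?nn_ge0.
have s1 : s = 1 \/ s = -1.
  by move/eqP: s2; rewrite sqrf_eq1 => /orP[] /eqP; [left|right].
pose g := c + s * sup S.
have gI : al < g < be.
  by rewrite /g /c; move: s0 sr; rewrite /r; case: s1 => ->; lra.
have gE x : s * rip (shiftT T g x) x = s * rip (shiftT T c x) x - sup S * nn x.
  by rewrite !rip_shiftT /g -/(nn x) -[in RHS](mul1r (sup S * _)) -s2; ring.
have [|d d0 hd] := gap_form_improve rP PQ s2 gI.
  by move=> x Dx Px; rewrite gE subr_ge0 Ssup.
pose t := Num.min (sup S + d) r.
have St : S t.
  split; first by rewrite /t le_min ge_min lexx orbT andbT (ltW r0) andbT addr_ge0// ltW.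
  move=> x Dx Px; apply: (@le_trans _ _ ((sup S + d) * nn x)).
    by rewrite ler_wpM2r ?nn_ge0// ge_min lexx.
  by have := hd x Dx Px; rewrite gE; lra.
have : t <= sup S by apply: sup_upper_bound.
by rewrite /t ge_min leNgt ltrDl d0 /= leNgt sr.
Qed.

(** The inverse B of T - c on the range of [Q] vanishes on the kernel of [Q], so the sign projection
    P of B is the identity there and commutes with [Q]. The two components are P Q and Q - P Q. *)
Lemma gap_splitting : exists Pp Pm,
  [/\ reducing T Pp, reducing T Pm, forall x, Q x = Pp x + Pm x,
      forall x y, rip (Pp x) (Pm y) = 0 &
    (forall x, dom T x -> Pp x = x -> 0 <= 1 * rip (shiftT T be x) x) /\
    (forall x, dom T x -> Pm x = x -> 0 <= -1 * rip (shiftT T al x) x)].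
Proof.
have cI : al < c < be by rewrite /c !midf_lt.
have [B [sB DB QB TB BT]] := solution_operator rQ (solveQ cI) (injQ cI).
have [P [prP PB Bp Bm P0]] := sign_splitting sB.
have [[sQ iQ] TQ] := rQ; have [sP iP] := prP.
have P_ker x : Q x = 0 -> P x = x.
  move=> Qx; apply: P0; apply: (injQ cI) => //.
  by rewrite TB.
have PQ x : P (Q x) = Q (P x).
  have e : P (x - Q x) = x - Q x by apply: P_ker; rewrite (rsymB _ _ sQ) iQ subrr.
  have e' z : Q z = z -> Q (P z) = P z.
    move=> Qz; apply: rip_inj => w; rewrite sQ sP.
    have ew : P (w - Q w) = w - Q w by apply: P_ker; rewrite (rsymB _ _ sQ) iQ subrr.
    have : rip z (P (w - Q w)) = 0 by rewrite ew ripDr ripNr -sQ Qz subrr.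
    by rewrite (rsymB _ _ sP) ripDr ripNr => /subr0_eq <-; rewrite sP.
  have Qe : Q (P (x - Q x)) = 0 by rewrite e (rsymB _ _ sQ) iQ subrr.
  move: Qe; rewrite (rsymB _ _ sP) (rsymB _ _ sQ) => /subr0_eq ->.
  by rewrite e'.
pose Pp x := P (Q x).
have rPp : reducing T Pp.
  split; [split|].
  - by move=> x y; rewrite /Pp sP sQ PQ.
  - by move=> x; rewrite /Pp -PQ iQ iP.
  - move=> x Dx; have [DQx TQx] := TQ x Dx.
    (* Written as a value of [B], the component visibly lies in the domain of [T]. *)
    have Qx : Pp x = B (P (shiftT T c (Q x))) by rewrite -PB BT.
    rewrite Qx; split; first exact: DB.
    apply: (addIr (- (c%:C *: B (P (shiftT T c (Q x)))))); rewrite -/(shiftT _ _ _) TB.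
    rewrite -Qx /Pp -(rsymZ _ _ sP) -(rsymB _ _ sP) -TQx -/(shiftT _ _ _).
    by rewrite -PQ reducing_shift// iQ.
have QPp x : Q (Pp x) = Pp x by rewrite /Pp -PQ iQ.
have rPm := reducing_sub rQ rPp QPp.
set Pm := (fun x => _) in rPm.
have PpI x : Pp x = x -> Q x = x by move=> <-; rewrite QPp.
have PmI x : Pm x = x -> Q x = x by move=> <-; rewrite /Pm (rsymB _ _ sQ) iQ QPp.
have PmP x : Pm x = x -> P x = 0.
  by move=> <-; rewrite /Pm /Pp (rsymB _ _ sP) iP subrr.
exists Pp, Pm; split => //.
- by move=> x; rewrite /Pm addrC subrK.
- have [[sPp iPp] _] := rPp.
  move=> x y; rewrite sPp /Pm (rsymB _ _ sPp) iPp /Pp iQ subrr rip0r//.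
split.
- move=> x Dx Px; have Qx := PpI x Px.
  have Px' : P x = x by rewrite -{2}Px /Pp Qx.
  have := @gap_form Pp 1 rPp PpI (expr1n _ _) _ x Dx Px.
  rewrite !mul1r !rip_shiftT -/(nn x) => h.
  suff : r * nn x <= rip (T x) x - c * nn x by rewrite /r /c; lra.
  apply: h => z Dz Pz; have Qz := PpI z Pz.
  have Pz' : P z = z by rewrite -{2}Pz /Pp Qz.
  (* The form of [B] at (T - c) z is the form of T - c at z, so the sign carries over. *)
  have := Bp (shiftT T c z); rewrite -PB BT// Pz' -sP Pz'.
  by rewrite mul1r ripC.
- move=> x Dx Px; have Qx := PmI x Px.
  have s2 : (-1 : R) ^+ 2 = 1 by rewrite sqrrN expr1n.
  have := @gap_form Pm (-1) rPm PmI s2 _ x Dx Px.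
  rewrite !rip_shiftT -/(nn x) => h.
  suff : r * nn x <= - 1 * (rip (T x) x - c * nn x) by rewrite /r /c; lra.
  apply: h => z Dz Pz; have Qz := PmI z Pz.
  have PTz : P (shiftT T c z) = 0.
    apply: PmP; rewrite reducing_shift// Pz//.
  have := Bm (shiftT T c z); rewrite PTz subr0 BT// ripC.
  by rewrite mulN1r oppr_ge0.
Qed.

End SpectralGap.

(** * Finite spans *)

Section FiniteSpan.
Local Open Scope complex_scope.
Context {R : realType} {H : hilbertType R}.
Implicit Types (x y z : H) (E : seq H).

Lemma inner0l x : inner 0 x = 0.
Proof. by rewrite -(scale0r 0) innerZl mul0r. Qed.

Definition subspace (D : set H) :=
  D 0 /\ forall (c : R[i]) u v, D u -> D v -> D (c *: u + v).

(** The complex span as an intersection of subspaces: membership is used by choosing [D], in place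
    of inductions over coefficients. *)
Definition fspan E : set H :=
  [set p | forall D, subspace D -> (forall e, e \in E -> D e) -> D p].

Lemma fspan_subspace E : subspace (fspan E).
Proof.
split=> [D [] //|c u v Du Dv D sD DE].
by apply: (proj2 sD); [apply: Du|apply: Dv].
Qed.

Lemma fspan_mem E e : e \in E -> fspan E e.
Proof. by move=> eE D _; apply. Qed.

Lemma subspaceZ D (c : R[i]) u : subspace D -> D u -> D (c *: u).
Proof. by move=> [D0 Dl] Du; rewrite -[_ *: _]addr0; apply: Dl. Qed.

Lemma subspaceD D u v : subspace D -> D u -> D v -> D (u + v).
Proof. by move=> [D0 Dl] Du Dv; rewrite -[u]scale1r; apply: Dl. Qed.

Lemma subspaceB D u v : subspace D -> D u -> D v -> D (u - v).
Proof.
by move=> sD Du Dv; apply: subspaceD => //; rewrite -scaleN1r; apply: subspaceZ.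
Qed.

Lemma fspan_ortho E x p : (forall e, e \in E -> inner x e = 0) -> fspan E p ->
  inner x p = 0.
Proof.
move=> xE pE; apply: (pE [set q | inner x q = 0]) => //.
split=> [|c u v /= hu hv] /=; first by rewrite innerC inner0l conjc0.
by rewrite innerDr innerZr hu hv mulr0 addr0.
Qed.

(** Gram-Schmidt: a new vector f contributes only its component f - q orthogonal to the earlier
    ones, and nothing if that component is zero. *)
Lemma fspan_proj E x :
  exists2 p, fspan E p & forall e, e \in E -> inner (x - p) e = 0.
Proof.
elim: E x => [x|f E IH x]; first by exists 0 => // D [].
have mono p : fspan E p -> fspan (f :: E) p.
  by move=> h D sD DE; apply: h => // e eE; apply: DE; rewrite inE eE orbT.
have [q qE qo] := IH f; have [p pE po] := IH x.
have fqE : fspan (f :: E) (f - q).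
  apply: (subspaceB (fspan_subspace _)); last exact: mono.
  by apply: fspan_mem; rewrite inE eqxx.
have [fq|fq] := eqVneq (f - q) 0.
  exists p => [|e]; first exact: mono.
  rewrite inE => /predU1P[->|]; last exact: po.
  by rewrite (subr0_eq fq); apply: fspan_ortho qE.
pose k := inner (x - p) (f - q) / inner (f - q) (f - q).
have nz : inner (f - q) (f - q) != 0.
  by rewrite inner_nn (inj_eq (@complexI R)) nn_eq0.
exists (k *: (f - q) + p).
  apply: (proj2 (fspan_subspace (f :: E))) => //; exact: mono.
have ko : inner (x - (k *: (f - q) + p)) (f - q) = 0.
  rewrite opprD addrCA addrC innerDl -scaleNr innerZl mulNr /k divfK//.
  by rewrite subrr.
have Eo e : e \in E -> inner (x - (k *: (f - q) + p)) e = 0.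
  move=> eE; rewrite opprD addrCA addrC innerDl -scaleNr innerZl qo// po//.
  by rewrite mulr0 addr0.
move=> e; rewrite inE => /predU1P[->|]; last exact: Eo.
have := innerDr (x - (k *: (f - q) + p)) (f - q) q; rewrite subrK ko add0r => ->.
exact: fspan_ortho qE.
Qed.

End FiniteSpan.

(** * The orthogonal complement of the eigenvectors in the gap *)

Section GapComplement.
Local Open Scope complex_scope.
Context {R : realType} {H : hilbertType R} (T : operator H).
Hypothesis saT : self_adjoint T.
Implicit Types (x y z : H) (P Q : H -> H).
Variables (al be : R) (E : seq H).
Hypothesis al_be : al < be.
Hypothesis E_eigen : forall e, e \in E ->
  dom T e /\ exists mu : R, T e = mu%:C *: e.
Hypothesis E_span : forall mu x, al < mu < be -> dom T x ->
  shiftT T mu x = 0 -> fspan E x.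
Hypothesis T_fredholm : forall mu, al < mu < be -> fredholm (op_shift T mu%:C).

Lemma fspan_dom x : fspan E x -> dom T x /\ fspan E (T x).
Proof.
move=> Ex; apply: (Ex [set z | dom T z /\ fspan E (T z)]).
  split=> [|c u v /= [Du Tu] [Dv Tv]] /=.
    by rewrite op0; split; [exact: dom0|exact: (proj1 (fspan_subspace E))].
  split; first exact: dom_linear.
  by rewrite op_linear//; apply: (proj2 (fspan_subspace E)).
move=> e eE /=; have [De [mu ->]] := E_eigen eE; split=> //.
apply: (subspaceZ _ (fspan_subspace E)); exact: fspan_mem.
Qed.

(** [Q] projects onto the complement of the span of [E], which reduces T because [E] consists of
    eigenvectors. All eigenvectors with eigenvalue in the gap lie in that span, whence injectivity;
    the Fredholm property then gives solvability. *)
Lemma gap_complement : exists Q, [/\ reducing T Q,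
  forall mu, al < mu < be ->
    forall y, exists x, [/\ dom T x, Q x = x & shiftT T mu x = Q y],
  forall mu, al < mu < be ->
    forall x, dom T x -> Q x = x -> shiftT T mu x = 0 -> x = 0 &
  forall x, (forall e, e \in E -> inner x e = 0) -> Q x = x].
Proof.
have /choice[P PP] : forall x, exists p, fspan E p /\
    forall e, e \in E -> inner (x - p) e = 0.
  by move=> x; have [p] := fspan_proj E x; exists p.
have PE x : fspan E (P x) by have [] := PP x.
have Po x p : fspan E p -> inner (x - P x) p = 0.
  by apply: fspan_ortho; have [] := PP x.
have Pu x p : fspan E p -> (forall e, e \in E -> inner (x - p) e = 0) -> P x = p.
  move=> Ep xp; apply/subr0_eq/eqP; rewrite -nn_eq0.
  have d : fspan E (P x - p) by apply: (subspaceB (fspan_subspace E)).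
  have h1 : rip (x - p) (P x - p) = 0 by rewrite /rip (fspan_ortho xp d).
  have h2 : rip (x - P x) (P x - p) = 0 by rewrite /rip Po.
  apply/eqP; move: h1 h2; rewrite /nn !ripE; lra.
have Pid p : fspan E p -> P p = p.
  by move=> Ep; apply: Pu => // e _; rewrite subrr inner0l.
have Pr x p : fspan E p -> rip (x - P x) p = 0 by move=> Ep; rewrite /rip Po.
have prP : is_proj P.
  split=> [x y|x]; last exact: Pid.
  have := Pr x _ (PE y); have := Pr y _ (PE x).
  by rewrite !ripE (ripC y) (ripC (P y)); lra.
have rP : reducing T P.
  split=> // x Dx; have [DP TP] := fspan_dom (PE x); split=> //.
  apply/esym/Pu => // e eE; rewrite -opB// sa_inner//.
  - by have [_ [mu ->]] := E_eigen eE; rewrite innerZr Po ?mulr0//; exact: fspan_mem.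
  - exact: domB.
  - by have [] := E_eigen eE.
have rid : reducing T id by [].
have rQ := reducing_sub rid rP (fun=> erefl).
exists (fun x => x - P x); split=> //.
- move=> mu mI y.
  have [|x Dx Tx] := fredholm_solve saT (T_fredholm mI) (y := y - P y).
    by move=> x Dx Tx; rewrite Pr//; apply: E_span Tx.
  have [[sQ iQ] TQ] := rQ; have [DQ _] := TQ x Dx.
  exists (x - P x); split=> //.
  have e := reducing_shift mu rQ Dx; rewrite /= in e.
  by rewrite -e Tx; exact: iQ.
- move=> mu mI x Dx Qx Tx; rewrite -Qx Pid ?subrr//.
  exact: E_span Tx.
- move=> x xE; rewrite (@Pu x 0) ?subr0//.
    exact: (proj1 (fspan_subspace E)).
Qed.

(* The Davis-Kahan type argument: on the orthogonal complement of [E], test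
   [T + A - c] against the difference of the two spectral components. *)
Lemma gap_lower_bound (A : operator H) (al' be' : R) :
  dom T `<=` dom A ->
  (forall x y, dom T x -> dom T y -> rip (A x) y = rip x (A y)) ->
  (forall P, reducing T P ->
    (forall x, dom T x -> P x = x -> 0 <= 1 * rip (shiftT T be x) x) ->
    forall x, dom T x -> P x = x -> be' * nn x <= rip (T x) x + rip (A x) x) ->
  (forall P, reducing T P ->
    (forall x, dom T x -> P x = x -> 0 <= -1 * rip (shiftT T al x) x) ->
    forall x, dom T x -> P x = x -> rip (T x) x + rip (A x) x <= al' * nn x) ->
  forall x, dom T x -> (forall e, e \in E -> inner x e = 0) ->
    (be' - al') / 2 * hn x <= hn (T x + A x - ((al' + be') / 2)%:C *: x).
Proof.
move=> TA sA hp hm x Dx xE.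
have [Q [rQ solQ injQ QE]] := gap_complement.
have [Pp [Pm [rp rm Qpm opm [bp bm]]]] := gap_splitting saT al_be rQ solQ injQ.
have [[sp ip] Tp] := rp; have [[sm im] Tm] := rm.
set c := (al' + be') / 2.
have xpm : x = Pp x + Pm x by rewrite -Qpm QE.
set p := Pp x in xpm; set q := Pm x in xpm.
have Dp : dom T p by have [] := Tp x Dx.
have Dq : dom T q by have [] := Tm x Dx.
have pq : rip p q = 0 by apply: opm.
have nx : nn x = nn p + nn q by rewrite xpm nnD pq; ring.
have hpp := hp Pp rp bp p Dp (ip x).
have hqq := hm Pm rm bm q Dq (im x).
set v := T x + A x - c%:C *: x.
(* The mixed terms of p and q occur with opposite signs and cancel, as T and [A] are symmetric. *)
have vE : rip v (p - q) = (rip (T p) p + rip (A p) p - c * nn p)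
                        - (rip (T q) q + rip (A q) q - c * nn q).
  rewrite /v xpm !opD//; try exact: TA.
  rewrite !ripE (sa_rip saT Dq Dp) (sA q p)// (ripC q p) pq.
  rewrite (ripC q (T p)) (ripC q (A p)) /nn; ring.
have le1 : (be' - al') / 2 * nn x <= rip v (p - q).
  by rewrite vE nx /c; lra.
have npq : hn (p - q) = hn x by rewrite /hn nx nnB pq mulr0 subr0.
have := le_trans le1 (le_trans (ler_norm _) (rip_le v (p - q))).
rewrite npq -sqr_hn expr2 mulrA.
have [->|x0] := eqVneq (hn x) 0; first by rewrite !mulr0 hn_ge0.
by rewrite ler_pM2r// lt_neqAle hn_ge0 andbT eq_sym.
Qed.

End GapComplement.

(** * Families of eigenvectors *)

Section EigenFamilies.
Local Open Scope complex_scope.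
Context {R : realType} {H : hilbertType R} (C : operator H).
Implicit Types (x y z : H) (l : R[i]) (F : seq (R[i] * H)).
Hypothesis symC : forall x y, dom C x -> dom C y -> inner (C x) y = inner x (C y).

(** The squared modulus, with values in [R]. *)
Definition sqm (l : R[i]) : R := complex.Re l ^+ 2 + complex.Im l ^+ 2.

Lemma sqmM (l : R[i]) (t : R) : sqm (l * t%:C) = sqm l * t ^+ 2.
Proof. by case: l => u v; rewrite /sqm /=; ring. Qed.

Lemma sqm_ge0 l : 0 <= sqm l. Proof. by rewrite addr_ge0 ?sqr_ge0. Qed.

Lemma sqm_eq0 l : (sqm l == 0) = (l == 0).
Proof. by case: l => u v; rewrite /sqm paddr_eq0 ?sqr_ge0// !sqrf_eq0 eq_complex. Qed.

Lemma inner_suml n (F : 'I_n -> H) y : inner (\sum_i F i) y = \sum_i inner (F i) y.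
Proof. by rewrite (big_morph (inner^~ y) (fun u v => innerDl u v y) (inner0l y)). Qed.

Lemma inner_sumr n (F : 'I_n -> H) y : inner y (\sum_i F i) = \sum_i inner y (F i).
Proof.
have i0 : inner y 0 = 0 by rewrite innerC inner0l conjc0.
by rewrite (big_morph (inner y) (innerDr y) i0).
Qed.

Lemma inner_lin_comb n (w : 'I_n -> H) (c : 'I_n -> R[i]) j :
  (forall i j, i != j -> inner (w i) (w j) = 0) ->
  inner (lin_comb w c) (w j) = c j * inner (w j) (w j).
Proof.
move=> wo; rewrite /lin_comb inner_suml (bigD1 j)//= big1 ?addr0 ?innerZl//.
by move=> i ij; rewrite innerZl wo// mulr0.
Qed.

Lemma nn_lin_comb n (w : 'I_n -> H) (c : 'I_n -> R[i]) :
  (forall i j, i != j -> inner (w i) (w j) = 0) ->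
  nn (lin_comb w c) = \sum_i sqm (c i) * nn (w i).
Proof.
move=> wo; apply: (@complexI R); rewrite -inner_nn {2}/lin_comb inner_sumr rmorph_sum /=.
apply: eq_bigr => i _; rewrite innerZr inner_lin_comb// inner_nn /sqm.
by case: (c i) => u v; apply/eqP; rewrite eq_complex /=; apply/andP; split; apply/eqP; ring.
Qed.

Lemma lin_comb_dom n (w : 'I_n -> H) (c l : 'I_n -> R[i]) :
  (forall i, dom C (w i)) -> (forall i, C (w i) = l i *: w i) ->
  dom C (lin_comb w c) /\ C (lin_comb w c) = lin_comb w (fun i => c i * l i).
Proof.
move=> Dw Cw; rewrite /lin_comb.
elim/big_rec2: _ => [|i y x _ [Dx Cx]]; first by rewrite op0; split; [exact: dom0|].
by split; [exact: dom_linear|rewrite op_linear// Cx Cw scalerA].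
Qed.

(** Pairs of an eigenvalue and an eigenvector; multiplicity shows as repetition of the first
    component. *)
Definition eigen_family (S : set R[i]) F : Prop :=
  (forall p, p \in F -> [/\ S p.1, dom C p.2, p.2 != 0 & C p.2 = p.1 *: p.2]) /\
  pairwise (fun p q => inner p.2 q.2 == 0) F.

Lemma eigen_family_ortho S F : eigen_family S F ->
  forall i j, (i < size F)%N -> (j < size F)%N -> i != j ->
  inner (nth (0, 0) F i).2 (nth (0, 0) F j).2 = 0.
Proof.
move=> [_ /(pairwiseP (0, 0)) pF] i j iF jF; rewrite neq_ltn => /orP[] ij.
  by apply/eqP/pF.
by rewrite innerC (eqP (pF _ _ jF iF ij)) conjc0.
Qed.

(* More than [size E] eigenvectors have a nonzero combination orthogonal to
   [E], which the lower bound forbids. *)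
Lemma eigen_family_size (E : seq H) (al be : R) F :
  (forall x, dom C x -> (forall e, e \in E -> inner x e = 0) ->
     (be - al) / 2 * hn x <= hn (C x - ((al + be) / 2)%:C *: x)) ->
  eigen_family (complex_itv al be) F -> (size F <= size E)%N.
Proof.
move=> lb FF; have Fo := eigen_family_ortho FF; have [Fe _] := FF.
rewrite leqNgt; apply/negP => EF.
pose w (i : 'I_(size F)) := (nth (0, 0) F i).2.
have Fi (i : 'I_(size F)) := Fe _ (mem_nth (0, 0) (ltn_ord i)).
have wo i j : i != j -> inner (w i) (w j) = 0 by move=> ij; apply: Fo.
pose M := \matrix_(i < size F, j < size E) inner (w i) (nth 0 E j).
have /rowV0Pn[u /sub_kermxP uM u0] : kermx M != 0.
  rewrite kermx_eq0 /row_free; apply/eqP => rM.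
  by have := rank_leq_col M; rewrite rM leqNgt EF.
pose x := lin_comb w (u 0).
have /choice[t tP] : forall i : 'I_(size F), exists t : R,
    al < t < be /\ (nth (0, 0) F i).1 = t%:C.
  by move=> i; have [[t /= tI <-] _ _ _] := Fi i; exists t; rewrite in_itv/= in tI.
have [Dx Cx] : dom C x /\ C x = lin_comb w (fun i => u 0 i * (t i)%:C).
  apply: lin_comb_dom => i; have [_ ? _] := Fi i => //.
  by rewrite (tP i).2.
have xE e : e \in E -> inner x e = 0.
  move=> /(nthP 0)[j jE <-]; have /matrixP/(_ 0 (Ordinal jE)) := uM.
  rewrite !mxE => e0; rewrite -[RHS]e0 /x /lin_comb inner_suml.
  by apply: eq_bigr => i _; rewrite mxE innerZl.
have := lb x Dx xE; apply/negP; rewrite -ltNge.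
have r0 : 0 <= (be - al) / 2.
  have [i _] : exists i : 'I_(size F), true by exists (Ordinal (leq_ltn_trans (leq0n _) EF)).
  by have [/andP[h1 h2] _] := tP i; rewrite divr_ge0// subr_ge0 ltW// (lt_trans h1).
set v := C x - _.
(* By Pythagoras both sides are sums over the family. Each eigenvalue is closer to the midpoint than
   half the width, and some coefficient is nonzero, so the inequality is strict. *)
suff: hn v ^+ 2 < ((be - al) / 2 * hn x) ^+ 2.
  by have := hn_ge0 v; have := mulr_ge0 r0 (hn_ge0 x); move: (_ * hn x) (hn v) => p q; nra.
rewrite exprMn !sqr_hn {}/v.
have -> : C x - ((al + be) / 2)%:C *: x =
    lin_comb w (fun i => u 0 i * (t i - (al + be) / 2)%:C).
  rewrite Cx /x /lin_comb scaler_sumr -sumrB; apply: eq_bigr => i _.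
  by rewrite scalerA -scalerBl rmorphB mulrBr [X in _ - X]mulrC.
rewrite !nn_lin_comb// mulr_sumr.
have sqlt (i : 'I_(size F)) : (t i - (al + be) / 2) ^+ 2 < ((be - al) / 2) ^+ 2.
  by have [/andP[h1 h2] _] := tP i; nra.
have nw (i : 'I_(size F)) : 0 < nn (w i).
  by have [_ _ w0 _] := Fi i; rewrite nn_gt0.
have [i ui] : exists i, u 0 i != 0.
  apply/existsP; apply: contraNT u0 => /existsPn h.
  by apply/eqP/rowP => i; rewrite mxE; apply/eqP; have := h i; rewrite negbK.
rewrite (bigD1 i)//= [ltRHS](bigD1 i)//= ltr_leD//.
  have su : 0 < sqm (u 0 i) by rewrite lt_neqAle sqm_ge0 eq_sym sqm_eq0 ui.
  by rewrite sqmM [ltRHS]mulrCA -mulrA ltr_pM2l// ltr_pM2r.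
apply: ler_sum => j _; rewrite sqmM [leRHS]mulrCA -mulrA ler_wpM2l ?sqm_ge0//.
by rewrite ler_pM2r// ltW.
Qed.

(* A family of maximal size spans every eigenspace. *)
Lemma eigen_family_mult (S : set R[i]) (n : nat) (V : R[i] -> set H) :
  S `<=` eigenvalues C -> (forall l, S l -> conjc l = l) ->
  (forall l, S l -> V l = [set x | dom C x /\ C x = l *: x]) ->
  (forall F, eigen_family S F -> (size F <= n)%N) ->
  exists2 k, (k <= n)%N & total_mult S V k.
Proof.
move=> SC Sreal VE Fn.
pose hasF k := `[< exists F, eigen_family S F /\ size F = k >].
have exF : exists k, hasF k by exists 0%N; apply/asboolP; exists [::].
have leF k : hasF k -> (k <= n)%N by move=> /asboolP[F [FF <-]]; apply: Fn.
case: (ex_maxnP exF leF) => k /asboolP[F [FF <-]] Fmax {k}.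
have [Fe Fp] := FF.
have eigen_ortho l l' x y : S l -> S l' -> l != l' -> dom C x -> dom C y ->
    C x = l *: x -> C y = l' *: y -> inner x y = 0.
  move=> Sl Sl' ll' Dx Dy Cx Cy.
  have := symC Dx Dy; rewrite Cx Cy innerZl innerZr Sreal// => /eqP.
  by rewrite -subr_eq0 -mulrBl mulf_eq0 subr_eq0 (negbTE ll') => /eqP.
(* Eigenvectors for other eigenvalues are orthogonal to [x] anyway, so a nonzero [x] of this kind
   could be added to [F], against maximality. *)
have extend l x : S l -> dom C x -> C x = l *: x ->
    (forall p, p \in F -> p.1 = l -> inner x p.2 = 0) -> x = 0.
  move=> Sl Dx Cx xF; apply: contrapT => /eqP x0.
  suff : hasF (size F).+1 by move=> /Fmax; rewrite ltnn.
  apply/asboolP; exists ((l, x) :: F); split=> //; split=> /=.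
    by move=> p; rewrite inE => /predU1P[->|/Fe].
  rewrite Fp andbT; apply/allP => p pF /=; apply/eqP.
  have [Sp Dp _ Cp] := Fe p pF.
  by have [/xF->//|pl] := eqVneq p.1 l; apply: (eigen_ortho l p.1); rewrite 1?eq_sym.
exists (size F); first by apply: Fn.
pose d l := count (fun p : R[i] * H => p.1 == l) F.
exists (undup [seq p.1 | p <- F]), d; split.
- exact: undup_uniq.
- apply/seteqP; split=> l /=; rewrite mem_undup.
    move=> Sl; apply: contrapT => /negP lF.
    have [x [Dx /eqP x0 Cx]] := SC l Sl; apply: x0.
    apply: (extend l) => // p pF pl; move: lF; rewrite -pl.
    by rewrite map_f.
  by move=> /mapP[p /Fe[Sp _ _ _] ->].
- move=> l; rewrite mem_undup => /mapP[p0 /Fe[Sl _ _ _] e].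
  rewrite -e in Sl; rewrite VE//; rewrite {p0 e}/d -size_filter.
  set G := [seq p <- F | _].
  have GF p : p \in G -> p \in F /\ p.1 = l.
    by rewrite mem_filter => /andP[/eqP].
  have GG : eigen_family S G.
    split=> [p /GF[/Fe//]|].
    exact: pairwise_filter.
  pose w (i : 'I_(size G)) := (nth (0, 0) G i).2.
  have wo i j : i != j -> inner (w i) (w j) = 0.
    by move=> ij; apply: (eigen_family_ortho GG).
  have wP i : [/\ dom C (w i), w i != 0 & C (w i) = l *: w i].
    have [iF il] := GF _ (mem_nth (0, 0) (ltn_ord i)).
    by have [_ ? ? ?] := Fe _ iF; rewrite -il.
  exists w.
    move=> c c0 i; have := inner_lin_comb c i wo; rewrite c0 inner0l => /esym/eqP.
    rewrite mulf_eq0 => /orP[/eqP//|]; rewrite inner_nn (inj_eq (@complexI R)) nn_eq0.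
    by have [_ /negbTE->] := wP i.
  apply/seteqP; split=> [x [Dx Cx]|_ [c _ <-]] /=; last first.
    have [i|i|Dc Cc] := @lin_comb_dom _ w c (fun=> l); try by have [] := wP i.
    split=> //; rewrite Cc /lin_comb scaler_sumr; apply: eq_bigr => i _.
    by rewrite scalerA mulrC.
  pose c i := inner x (w i) / inner (w i) (w i).
  exists c => //; apply/esym/subr0_eq.
  have [i|i|Dc Cc] := @lin_comb_dom _ w c (fun=> l); try by have [] := wP i.
  apply: (extend l) => //; first exact: domB.
    rewrite opB// Cx Cc scalerBr; congr (_ - _).
    by rewrite /lin_comb scaler_sumr; apply: eq_bigr => i _; rewrite scalerA mulrC.
  move=> p pF pl; have /(nthP (0, 0))[i iG <-] : p \in G by rewrite mem_filter pl eqxx.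
  have wi : w (Ordinal iG) = (nth (0, 0) G i).2 by [].
  rewrite -wi; set j := Ordinal iG.
  rewrite -[- _]scaleN1r innerDl innerZl inner_lin_comb// /c divfK; last first.
    by rewrite inner_nn (inj_eq (@complexI R)) nn_eq0; have [] := wP j.
  by rewrite mulN1r subrr.
- rewrite -(size_map (fun p => p.1)) -sum1_size -[RHS]big_undup_iterop_count.
  apply: eq_bigr => l _; rewrite /d count_map.
  by rewrite Monoid.iteropE iter_addn addn0 mul1n.
Qed.

(** There are no Jordan chains: if y = (C - t) x is killed by C - t, then ||y||^2 = (x, (C - t) y) =
    0. Algebraic and geometric multiplicities therefore agree. *)
Lemma ker_pow_symmetric (t : R) k x :
  ker_pow (op_shift C t%:C) k x -> dom C x /\ C x = t%:C *: x.
Proof.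
have kerE z : op_shift C t%:C z = C z - t%:C *: z by rewrite /= scaleNr.
elim: k x => [x ->|k IH x [[Dx _]]]; first by rewrite op0 scaler0; split; [exact: dom0|].
rewrite kerE => /IH[Dy Cy]; split=> //; apply/subr0_eq/eqP.
set y := C x - _ in Dy Cy *.
rewrite -nn_eq0 -(inj_eq (@complexI R)) -inner_nn {2}/y.
rewrite -[- _]scaleN1r scalerA innerDr innerZr -symC// Cy innerZl mulN1r.
have -> : conjc (- t%:C) = - t%:C.
  by apply/eqP; rewrite eq_complex /= !oppr0 !eqxx.
by rewrite mulNr subrr.
Qed.

Lemma root_space_symmetric (t : R) :
  root_space C t%:C = [set x | dom C x /\ C x = t%:C *: x].
Proof.
apply/seteqP; split=> [x [k _]|x [Dx Cx]]; first exact: ker_pow_symmetric.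
by exists 1%N => //=; split=> //; rewrite Cx scaleNr subrr.
Qed.

End EigenFamilies.

Section TotalMultiplicity.
Local Open Scope complex_scope.
Context {R : realType} {H : hilbertType R}.

(** Concatenated bases; the size of [E] is the total multiplicity that later limits the eigenvectors
    of the perturbed operator. *)
Lemma total_mult_span (V : R[i] -> set H) (d : R[i] -> nat) (s : seq R[i]) :
  {in s, forall l, has_dim (V l) (d l)} ->
  exists E : seq H, [/\ size E = (\sum_(l <- s) d l)%N,
    forall e, e \in E -> exists2 l, l \in s & V l e &
    forall l, l \in s -> V l `<=` fspan E].
Proof.
elim: s => [_|l s IH sd]; first by exists [::]; rewrite big_nil.
have [|E [sE EV VE]] := IH.
  by move=> l' l's; apply: sd; rewrite inE l's orbT.
have [v _ Vl] := sd l (mem_head _ _).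
exists ([seq v i | i <- enum 'I_(d l)] ++ E); split.
- by rewrite size_cat size_map size_enum_ord sE big_cons.
- move=> e; rewrite mem_cat => /orP[/mapP[i _ ->]|/EV[l' l's Ve]]; last first.
    by exists l' => //; rewrite inE l's orbT.
  exists l; first exact: mem_head.
  rewrite Vl; exists (fun j => (j == i)%:R) => //.
  rewrite /lin_comb (bigD1 i)//= eqxx scale1r big1 ?addr0// => j /negbTE->.
  by rewrite scale0r.
- move=> l'; rewrite inE => /predU1P[->|/VE VE'] x.
    rewrite Vl => -[c _ <-]; rewrite /lin_comb.
    elim/big_ind: _ => [|u u'|i _]; first exact: (proj1 (fspan_subspace _)).
      exact: (subspaceD (fspan_subspace _)).
    apply: (subspaceZ _ (fspan_subspace _)); apply: fspan_mem.
    by rewrite mem_cat map_f ?mem_enum.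
  move=> /VE' xE D sD DE; apply: xE => // e eE; apply: DE.
  by rewrite mem_cat eE orbT.
Qed.

End TotalMultiplicity.

(** * Perturbation of the gap *)

Section Perturbation.
Local Open Scope complex_scope.
Context {R : realType} {H : hilbertType R} (T A : operator H).
Implicit Types (x y z : H) (P : H -> H).

Lemma real_num_range_mem x : dom A x -> x != 0 -> real_num_range A (rip (A x) x / nn x).
Proof.
move=> Dx x0; have hx : 0 < hn x by rewrite lt_neqAle hn_ge0 andbT eq_sym hn_eq0.
set k := (hn x)^-1; have Dk : dom A (k%:C *: x) by exact: domZ.
exists (inner (A (k%:C *: x)) (k%:C *: x)).
  exists (k%:C *: x) => //; split=> //=.
  by rewrite norm_hn hnZ gtr0_norm ?invr_gt0// mulVf// gt_eqF.
rewrite -/(rip _ _) opZ// ripZl ripZr -sqr_hn /k.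
by field; rewrite gt_eqF.
Qed.

Lemma num_range_le_sup x : bounded_above A -> dom A x -> rip (A x) x <= supW A * nn x.
Proof.
move=> ub Dx; have [->|x0] := eqVneq x 0; first by rewrite rip0r nn0 mulr0.
rewrite -ler_pdivrMr ?nn_gt0//; apply: sup_upper_bound; last exact: real_num_range_mem.
by split=> //; exists (rip (A x) x / nn x); exact: real_num_range_mem.
Qed.

Lemma num_range_ge_inf x : bounded_below A -> dom A x -> infW A * nn x <= rip (A x) x.
Proof.
move=> lb Dx; have [->|x0] := eqVneq x 0; first by rewrite rip0r nn0 mulr0.
rewrite -ler_pdivlMr ?nn_gt0//; apply: ge_inf => //; exact: real_num_range_mem.
Qed.

Lemma bounded_op_num_range : bounded_op A -> bounded_above A /\ bounded_below A.
Proof.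
move=> [M AM].
have h t : real_num_range A t -> `|t| <= M.
  move=> [_ [x [Dx /= x1] <-] <-].
  have hx : hn x = 1 by move: x1; rewrite norm_hn => /complexI.
  rewrite -/(rip _ _) (le_trans (rip_le _ _))// hx mulr1.
  by have := AM x Dx; rewrite !norm_hn -rmorphM lecR hx mulr1.
split; [exists M|exists (- M)] => t /h.
  by rewrite ler_norml => /andP[].
by rewrite ler_norml => /andP[].
Qed.

Lemma rel_ineq_nn a b x : rel_ineq T A a b -> dom T x ->
  nn (A x) <= a ^+ 2 * nn x + b ^+ 2 * nn (T x).
Proof.
move=> h Dx; have := h x Dx.
by rewrite !sqr_norm_nn -!rmorphM -rmorphD lecR.
Qed.

(* In the four cases the only information needed about [A] is how it shifts
   the two edges of the gap in the sense of quadratic forms. *)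
Lemma shifted_eigen_family_size (al be al' be' : R) (m : nat) :
  self_adjoint T -> symmetric_op A -> dom T `<=` dom A -> al < be ->
  ess_spectrum T `&` complex_itv al be = set0 ->
  total_mult (eigenvalues T `&` complex_itv al be) (op_eigenspace T) m ->
  (forall P, reducing T P ->
    (forall x, dom T x -> P x = x -> 0 <= 1 * rip (shiftT T be x) x) ->
    forall x, dom T x -> P x = x -> be' * nn x <= rip (T x) x + rip (A x) x) ->
  (forall P, reducing T P ->
    (forall x, dom T x -> P x = x -> 0 <= -1 * rip (shiftT T al x) x) ->
    forall x, dom T x -> P x = x -> rip (T x) x + rip (A x) x <= al' * nn x) ->
  forall F, eigen_family (op_add T A) (complex_itv al' be') F -> (size F <= m)%N.
Proof.
move=> saT [_ symA] TA al_be ess [s [d [us se sd <-]]] hp hm F FF.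
have [E [<- EV VE]] := total_mult_span sd.
have in_s l : l \in s <-> (eigenvalues T `&` complex_itv al be) l by rewrite se.
have shE mu x : op_shift T mu%:C x = shiftT T mu x by rewrite /shiftT /= scaleNr.
apply: (@eigen_family_size _ _ _ E al' be' F _ FF) => x [Dx _] xE.
have e_eigen e : e \in E -> dom T e /\ exists mu : R, T e = mu%:C *: e.
  move=> /EV[l /in_s[_ [mu _ <-]]] [[De _]]; rewrite shE => /subr0_eq Te.
  by split=> //; exists mu.
have e_span mu y : al < mu < be -> dom T y -> shiftT T mu y = 0 -> fspan E y.
  move=> muI Dy Ty; have [->|y0] := eqVneq y 0.
    exact: (proj1 (fspan_subspace E)).
  apply: (VE mu%:C); last by split; [|rewrite shE].
  apply/in_s; split; last by exists mu => //=; rewrite in_itv.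
  by exists y; split=> //; apply: subr0_eq Ty.
have fred mu : al < mu < be -> fredholm (op_shift T mu%:C).
  move=> muI; apply: contrapT => nf.
  have : (ess_spectrum T `&` complex_itv al be) mu%:C.
    by split=> //; exists mu => //=; rewrite in_itv.
  by rewrite ess.
have sA y z : dom T y -> dom T z -> rip (A y) z = rip y (A z).
  by move=> Dy Dz; rewrite /rip symA//; exact: TA.
exact: (gap_lower_bound saT al_be e_eigen e_span fred TA sA hp hm).
Qed.

End Perturbation.

Theorem theorem4p1 (R : realType) (H : hilbertType R) (T A : operator H)
    (alphaT betaT a b : R) (m : nat)
    (T_self_adjoint : self_adjoint T)
    (alphaT_lt_betaT : alphaT < betaT)
    (ess_gap : ess_spectrum T `&` complex_itv alphaT betaT = set0)
    (T_eigenvalues :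
      total_mult (eigenvalues T `&` complex_itv alphaT betaT) (op_eigenspace T) m)
    (A_symmetric : symmetric_op A)
    (A_rel_bounded : rel_bounded T A)
    (A_rel_bound : rel_bound T A < 1)
    (a_ge0 : 0 <= a) (b_ge0 : 0 <= b) (b_lt1 : b < 1)
    (A_rel_ineq : rel_ineq T A a b)
    (alphaTA betaTA : R)
    (cases :
      [\/ Num.sqrt (a ^+ 2 + b ^+ 2 * alphaT ^+ 2)
            + Num.sqrt (a ^+ 2 + b ^+ 2 * betaT ^+ 2) < betaT - alphaT /\
          (alphaTA, betaTA) =
            (alphaT + Num.sqrt (a ^+ 2 + b ^+ 2 * alphaT ^+ 2),
             betaT - Num.sqrt (a ^+ 2 + b ^+ 2 * betaT ^+ 2)),
          [/\ bounded_above A,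
              supW A + Num.sqrt (a ^+ 2 + b ^+ 2 * betaT ^+ 2)
                < betaT - alphaT
            & (alphaTA, betaTA) =
                (alphaT + supW A,
                 betaT - Num.sqrt (a ^+ 2 + b ^+ 2 * betaT ^+ 2))],
          [/\ bounded_below A,
              Num.sqrt (a ^+ 2 + b ^+ 2 * alphaT ^+ 2) - infW A
                < betaT - alphaT
            & (alphaTA, betaTA) =
                (alphaT + Num.sqrt (a ^+ 2 + b ^+ 2 * alphaT ^+ 2),
                 betaT + infW A)]
        | [/\ bounded_op A,
              supW A - infW A < betaT - alphaT
            & (alphaTA, betaTA) = (alphaT + supW A, betaT + infW A)]]) :
  (exists2 k : nat, (k <= m)%N &
     total_mult
       (isolated_eigenvalues (op_add T A) `&` complex_itv alphaTA betaTA)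
       (root_space (op_add T A)) k)
  /\ (eigenvalues T `&` complex_itv alphaT betaT = set0 ->
      eigenvalues (op_add T A) `&` complex_itv alphaTA betaTA = set0).
Proof.
have [TA _] := A_rel_bounded.
have sA x y : dom T x -> dom T y -> rip (A x) y = rip x (A y).
  by move=> Dx Dy; rewrite /rip (proj2 A_symmetric)//; exact: TA.
have Ab x := rel_ineq_nn (x := x) A_rel_ineq.
have form P t0 s := relative_form_bound (T := T) T_self_adjoint (P := P) (t0 := t0) (s := s)
  (a := a) (b := b) (A := A).
have s2 : (-1 : R) ^+ 2 = 1 by rewrite sqrrN expr1n.
(* [lower] concerns the part of [T] below the gap and bounds the perturbed form from above; [upper]
   does the reverse above the gap. *)
pose lower al' := forall P, reducing T P ->
    (forall x, dom T x -> P x = x -> 0 <= -1 * rip (shiftT T alphaT x) x) ->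
    forall x, dom T x -> P x = x -> rip (T x) x + rip (A x) x <= al' * nn x.
pose upper be' := forall P, reducing T P ->
    (forall x, dom T x -> P x = x -> 0 <= 1 * rip (shiftT T betaT x) x) ->
    forall x, dom T x -> P x = x -> be' * nn x <= rip (T x) x + rip (A x) x.
have low_rel : lower (alphaT + Num.sqrt (a ^+ 2 + b ^+ 2 * alphaT ^+ 2)).
  move=> P rP pos x Dx Px.
  by have := form P alphaT _ rP s2 b_lt1 b_ge0 sA Ab pos x Dx Px; lra.
have up_rel : upper (betaT - Num.sqrt (a ^+ 2 + b ^+ 2 * betaT ^+ 2)).
  move=> P rP pos x Dx Px.
  by have := form P betaT _ rP (expr1n _ 2) b_lt1 b_ge0 sA Ab pos x Dx Px; lra.
have low_sup : bounded_above A -> lower (alphaT + supW A).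
  move=> ubA P rP pos x Dx Px; have := num_range_le_sup ubA (TA x Dx).
  by have := pos x Dx Px; rewrite rip_shiftT -/(nn x); lra.
have up_inf : bounded_below A -> upper (betaT + infW A).
  move=> lbA P rP pos x Dx Px; have := num_range_ge_inf lbA (TA x Dx).
  by have := pos x Dx Px; rewrite rip_shiftT -/(nn x); lra.
have [lowTA upTA] : lower alphaTA /\ upper betaTA.
  case: cases => [[_ [-> ->]]|[ubA _ [-> ->]]|[lbA _ [-> ->]]|[bA _ [-> ->]]];
    split=> //; try exact: low_sup; try exact: up_inf.
  - by apply: low_sup; have [] := bounded_op_num_range bA.
  - by apply: up_inf; have [] := bounded_op_num_range bA.
have size_le n := @shifted_eigen_family_size R H T A alphaT betaT alphaTA betaTA n
  T_self_adjoint A_symmetric TA alphaT_lt_betaT ess_gap ^~ upTA ^~ lowTA.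
have symTA x y : dom (op_add T A) x -> dom (op_add T A) y ->
    inner (op_add T A x) y = inner x (op_add T A y).
  move=> [Dx Ax] [Dy Ay] /=; rewrite innerDl innerDr (sa_inner T_self_adjoint)//.
  by rewrite (proj2 A_symmetric).
split.
  apply: (eigen_family_mult symTA) => [l [[]]//|l [_ [t _ <-]]|l [_ [t _ <-]]|F FF].
  - exact: conjc_real.
  - exact: root_space_symmetric.
  apply: (size_le m T_eigenvalues); have [Fe Fp] := FF.
  by split=> // p /Fe[[_ pI]].
move=> noT; apply/seteqP; split=> // l [[x [Dx x0 Cx]] lI].
(* With total multiplicity 0 a family of one eigenvector is already too large; this rules out every
   eigenvalue in the interval, isolated or not. *)
have noT' : total_mult (eigenvalues T `&` complex_itv alphaT betaT) (op_eigenspace T) 0.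
  by exists [::], (fun=> 0%N); split=> //; rewrite ?big_nil// noT; apply/seteqP; split.
suff : (size [:: (l, x)] <= 0)%N by [].
apply: (size_le 0%N noT'); split=> //= p.
by rewrite inE => /eqP->.
Qed.
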